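(* Let $G$ be a non-abelian finitely generated group. Then the following conditions are equivalent: 1. $G$ is a limit of (generalized) quaternion groups. 2. $G$ is fully residually quaternion; i.e., for every finite subset $E \subseteq G$ there exist an integer $n \geq 3$ and a homomorphism $\alpha : G \to Q_{2^n}$ whose restriction to $E$ is injective. 3. There exist integers $l \geq 0$ and $k \geq 1$ such that $G$ is isomorphic to $$\frac{\mathbb{Z}_4 \ltimes (\mathbb{Z}^l \oplus \mathbb{Z}_{2^k})}{\langle (2, 2^{k-1}) \rangle},$$ where the action of $\mathbb{Z}_4$ on $\mathbb{Z}^l \oplus \mathbb{Z}_{2^k}$ is given by $x \cdot a = (-1)^x a$. 4. $\bigcap_{n \geq 3} \mathrm{Th}_{\forall}(Q_{2^n}) \subseteq \mathrm{Th}_{\forall}(G)$. 5. $G$ can be embedded in some ultra-product of (generalized) quaternion groups.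
   Context: Quaternion groups: ''quaternion group'' means generalized quaternion group, i.e. a group $Q_{2^n}$ with $n \geq 3$, where $$Q_{2^n} = \langle x, y \mid x^{2^{n-1}} = y^4 = 1,\ yxy^{-1} = x^{-1},\ x^{2^{n-2}} = y^2 \rangle ,$$ equivalently $Q_{2^n} = (\mathbb{Z}_4 \ltimes \mathbb{Z}_{2^{n-1}})/\langle (2, 2^{n-2}) \rangle$ with $\mathbb{Z}_4$ acting on $\mathbb{Z}_{2^{n-1}}$ by $x \cdot a = (-1)^x a$. Here $\mathbb{Z}_r$ denotes the cyclic group of order $r$, written additively. Notation in condition 3: in $(2, 2^{k-1})$, the entry $2$ is the element $2 \in \mathbb{Z}_4$, and $2^{k-1}$ denotes the element $(0, 2^{k-1}) \in \mathbb{Z}^l \oplus \mathbb{Z}_{2^k}$, i.e. the unique element of order two of the summand $\mathbb{Z}_{2^k}$. The subgroup $\langle (2, 2^{k-1}) \rangle$ is central of order two in the semidirect product (in which $\mathbb{Z}^l \oplus \mathbb{Z}_{2^k}$ is the normal factor). Space of marked groups: for an integer $m \geq 1$, a marked group $(G,S)$ consists of a group $G$ and an $m$-tuple $S = (s_1, \ldots, s_m)$ of elements generating $G$. Two marked groups $(G,S)$ and $(G',S')$ are identified if there is an isomorphism $G \to G'$ sending $s_i$ to $s_i'$ for every $i$. The set of all such marked groups is $\mathcal{G}_m$. Let $\mathbb{F}_m$ be the free group of rank $m$ with word length $\|\cdot\|$, and for a non-negative integer $\lambda$ put $$\mathrm{Rel}_{\lambda}(G,S) = \{ w \in \mathbb{F}_m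 : \|w\| \leq \lambda,\ w(S) = 1 \}.$$ The Gromov-Grigorchuk metric on $\mathcal{G}_m$ is $d((G,S),(G',S')) = e^{-\Lambda}$, where $\Lambda$ is the largest number with $\mathrm{Rel}_{\Lambda}(G,S) = \mathrm{Rel}_{\Lambda}(G',S')$ (and the distance is $0$ if equality holds for all $\lambda$). Thus $(G_i,S_i) \to (G,S)$ if and only if for each $\lambda$ one has $\mathrm{Rel}_{\lambda}(G_i,S_i) = \mathrm{Rel}_{\lambda}(G,S)$ for all sufficiently large $i$. A finitely generated group $G$ is a limit of quaternion groups if for some $m$ and some marking $(G,S) \in \mathcal{G}_m$ there is a sequence of marked groups $(G_i,S_i) \in \mathcal{G}_m$, each $G_i$ being a quaternion group, that converges to $(G,S)$ in $\mathcal{G}_m$. Universal theory: for a group $G$, $\mathrm{Th}_{\forall}(G)$ is the set of all first-order sentences in the language of groups $(1, {}^{-1}, \cdot)$ that are true in $G$ and whose (prenex) normal form has only universal quantifiers. Ultra-products: given a sequence of groups $(G_i)_{i \in \mathbb{N}}$ and an ultra-filter $\mathcal{U}$ on $\mathbb{N}$, the ultra-product $\prod_i G_i/\mathcal{U}$ is the quotient of $\prod_i G_i$ by the congruence $(x_i) \sim (y_i) \Leftrightarrow \{ i : x_i = y_i \} \in \mathcal{U}$. An ultra-product of quaternion groups is such a group with every $G_i$ a quaternion group. *)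

(* Defs.v *)
From HB Require Import structures.
From mathcomp Require Import all_boot all_order all_algebra.
From mathcomp Require Import fingroup extremal generic_quotient.
From mathcomp Require Import boolp classical_sets functions cardinality filter.
From mathcomp Require Import reals topology normedtype sequences exp.

Set Implicit Arguments.
Unset Strict Implicit.
Unset Printing Implicit Defensive.

Import Order.TTheory GRing.Theory Num.Theory.
Import numFieldNormedType.Exports.

Local Open Scope classical_set_scope.
Local Open Scope ring_scope.
Local Open Scope group_scope.
Local Open Scope quotient_scope.

(* A [groupType] is an arbitrary, possibly infinite, group: the choice
   structure it carries exists on every type by [gen_choiceMixin]. *)

Definition gembeds (G H : groupType) : Prop :=
  exists f : {multiplicative G -> H}, injective f.

Definition gisomorphic (G H : groupType) : Prop :=
  exists f : {multiplicative G -> H}, bijective f.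

Definition nonabelian (G : groupType) : Prop :=
  ~ (forall x y : G, commute x y).

Definition subgroup (G : groupType) (H : set G) : Prop :=
  [/\ H 1, forall x y, H x -> H y -> H (x * y) & forall x, H x -> H x^-1].

Definition normal_subgroup (G : groupType) (H : set G) : Prop :=
  subgroup H /\ forall x y, H x -> H (x ^ y).

Definition gspan (G : groupType) (A : set G) : set G :=
  smallest (@subgroup G) A.

Definition fin_generated (G : groupType) : Prop :=
  exists2 A : set G, finite_set A & gspan A = setT.

Record congruence (G : groupType) := Congruence {
  cong_rel :> G -> G -> Prop;
  cong_refl : forall x, cong_rel x x;
  cong_sym : forall x y, cong_rel x y -> cong_rel y x;
  cong_trans : forall x y z, cong_rel x y -> cong_rel y z -> cong_rel x z;
  congM : forall x x' y y',
    cong_rel x x' -> cong_rel y y' -> cong_rel (x * y) (x' * y')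
}.

Section CongruenceQuotient.
Variables (G : groupType) (C : congruence G).

Definition congb (x y : G) : bool := `[< C x y >].

Lemma congb_equiv : equiv_class_of congb.
Proof.
split=> [x | x y | y x z].
- exact/asboolP/cong_refl.
- by apply/asboolP/asboolP; apply: cong_sym.
- by move=> /asboolP xy /asboolP yz; apply/asboolP; apply: cong_trans yz.
Qed.

Canonical congb_equiv_rel := EquivRelPack congb_equiv.

Definition quotg : Type := {eq_quot congb_equiv_rel}.

HB.instance Definition _ := Choice.on quotg.
HB.instance Definition _ := Quotient.on quotg.

Definition quotg_pi (x : G) : quotg := \pi_quotg x.

Lemma quotg_piP x y : (quotg_pi x = quotg_pi y) <-> C x y.
Proof.
by split=> [/eqmodP/asboolP | xy]; last exact/eqmodP/asboolP.
Qed.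

Lemma quotg_pi_repr (u : quotg) : quotg_pi (repr u) = u.
Proof. exact: reprK. Qed.

Lemma quotg_repr_pi x : C (repr (quotg_pi x)) x.
Proof. by apply/quotg_piP; rewrite quotg_pi_repr. Qed.

Definition quotg_mul (u v : quotg) : quotg := quotg_pi (repr u * repr v).
Definition quotg_one : quotg := quotg_pi 1.
Definition quotg_inv (u : quotg) : quotg := quotg_pi (repr u)^-1.

Lemma quotg_mulE x y :
  quotg_mul (quotg_pi x) (quotg_pi y) = quotg_pi (x * y).
Proof. by apply/quotg_piP; apply: congM; apply: quotg_repr_pi. Qed.

Lemma quotg_mulA : associative quotg_mul.
Proof.
move=> u v w; rewrite -(quotg_pi_repr u) -(quotg_pi_repr v) -(quotg_pi_repr w).
by rewrite !quotg_mulE mulgA.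
Qed.

Lemma quotg_mul1 : left_id quotg_one quotg_mul.
Proof. by move=> u; rewrite -(quotg_pi_repr u) quotg_mulE mul1g. Qed.

Lemma quotg_1mul : right_id quotg_one quotg_mul.
Proof. by move=> u; rewrite -(quotg_pi_repr u) quotg_mulE mulg1. Qed.

Lemma quotg_mulV : left_inverse quotg_one quotg_inv quotg_mul.
Proof.
by move=> u; rewrite -{2}(quotg_pi_repr u) quotg_mulE mulVg.
Qed.

Lemma quotg_Vmul : right_inverse quotg_one quotg_inv quotg_mul.
Proof.
by move=> u; rewrite -{1}(quotg_pi_repr u) quotg_mulE mulgV.
Qed.

HB.instance Definition _ := isGroup.Build quotg
  quotg_mulA quotg_mul1 quotg_1mul quotg_mulV quotg_Vmul.

Lemma quotg_pi_morph : {morph quotg_pi : x y / x * y}.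
Proof. by move=> x y; rewrite -quotg_mulE. Qed.

End CongruenceQuotient.

Section NormalQuotient.
Variables (G : groupType) (N : set G) (nN : normal_subgroup N).

Definition coset_rel (x y : G) : Prop := N (x^-1 * y).

Lemma coset_rel_refl x : coset_rel x x.
Proof. by rewrite /coset_rel mulVg; case: nN => [[]]. Qed.

Lemma coset_rel_sym x y : coset_rel x y -> coset_rel y x.
Proof.
case: nN => [[_ _ NV] _] /NV; by rewrite /coset_rel invgM invgK.
Qed.

Lemma coset_rel_trans x y z :
  coset_rel x y -> coset_rel y z -> coset_rel x z.
Proof.
case: nN => [[_ NM _] _] xy yz; move: (NM _ _ xy yz).
by rewrite /coset_rel -mulgA mulVKg.
Qed.

Lemma coset_relM x x' y y' :
  coset_rel x x' -> coset_rel y y' -> coset_rel (x * y) (x' * y').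
Proof.
case: nN => [[_ NM _] NJ] xx' yy'; rewrite /coset_rel.
have -> : (x * y)^-1 * (x' * y') = (x^-1 * x') ^ y * (y^-1 * y').
  by rewrite conjgE invgM !mulgA mulgK.
by apply: NM => //; apply: NJ.
Qed.

Definition coset_congruence : congruence G :=
  Congruence coset_rel_refl coset_rel_sym coset_rel_trans coset_relM.

Definition quot_normal : groupType := quotg coset_congruence.

End NormalQuotient.

Lemma gspan_central_normal (G : groupType) (z : G) :
  (forall x, commute z x) -> normal_subgroup (gspan [set z]).
Proof.
move=> cz; split.
  split; first by move=> H [[H1 _ _] _].
    move=> x y Hx Hy H HH; have [[_ HM _] _] := HH.
    by apply: HM; [apply: Hx | apply: Hy].
  by move=> x Hx H HH; have [[_ _ HV] _] := HH; apply: HV; apply: Hx.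
move=> x y Hx; suff -> : x ^ y = x by [].
have cx : commute x y.
  apply: (Hx [set u | commute u y]); split; last by move=> _ ->; apply: cz.
  split=> [|u v uy vy|u uy] /=.
  - exact/commute_sym/commute1.
  - by apply/commute_sym/commuteM; apply: commute_sym.
  - exact/commute_sym/commuteV/commute_sym.
by rewrite conjgE cx mulKg.
Qed.

(* For n >= 3, [card_quaternion] and [Grp_quaternion] give the order 2 ^ n and
   the presentation x ^ 2^(n-1) = 1, y ^ 2 = x ^ 2^(n-2), x ^ y = x^-1. *)
Definition quaternion (n : nat) : groupType := ('Q_(2 ^ n))%type.

Definition quaternion_group (H : groupType) : Prop :=
  exists2 n : nat, (3 <= n)%N & gisomorphic H (quaternion n).

(* The semidirect product of Z_4 and an additive group A, where x in Z_4 acts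
   by a |-> (-1)^x a; the pair (x, a) stands for the product a x. *)
Section Z4Semidirect.
Variable A : zmodType.

Definition z4sdprod : Type := ('Z_4 * A)%type.

HB.instance Definition _ := Choice.on z4sdprod.

Definition z4act (x : 'Z_4) (a : A) : A := (a *~ (-1) ^+ (x : nat))%R.

Definition z4sd_mul (u v : z4sdprod) : z4sdprod :=
  ((u.1 + v.1)%R, (u.2 + z4act u.1 v.2)%R).
Definition z4sd_one : z4sdprod := (0%R, 0%R).
Definition z4sd_inv (u : z4sdprod) : z4sdprod :=
  ((- u.1)%R, (- z4act (- u.1)%R u.2)%R).

Lemma z4act0 a : z4act 0%R a = a.
Proof. by rewrite /z4act expr0. Qed.

Lemma z4actD x y a : z4act (x + y)%R a = z4act x (z4act y a).
Proof.
rewrite /z4act -mulrzA -exprD; congr (_ *~ _)%R.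
rewrite -signr_odd -[RHS]signr_odd /= oddD addbC.
by congr (_ ^+ (nat_of_bool _))%R; case: x y => [[|[|[|[|?]]]] ?] [[|[|[|[|?]]]] ?].
Qed.

Lemma z4actDr x a b : z4act x (a + b)%R = (z4act x a + z4act x b)%R.
Proof. exact: mulrzDl. Qed.

Lemma z4actNr x a : z4act x (- a)%R = (- z4act x a)%R.
Proof. exact: mulNrz. Qed.

Lemma z4actr0 x : z4act x 0%R = 0%R.
Proof. exact: mul0rz. Qed.

Lemma z4sd_mulA : associative z4sd_mul.
Proof.
by move=> u v w; rewrite /z4sd_mul /= z4actD z4actDr !addrA.
Qed.

Lemma z4sd_mul1 : left_id z4sd_one z4sd_mul.
Proof.
case=> x a; apply: (congr2 pair); first exact: add0r.
by rewrite [LHS]add0r; apply: z4act0.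
Qed.

Lemma z4sd_1mul : right_id z4sd_one z4sd_mul.
Proof.
case=> x a; apply: (congr2 pair); first exact: addr0.
by rewrite z4actr0; apply: addr0.
Qed.

Lemma z4sd_mulV : left_inverse z4sd_one z4sd_inv z4sd_mul.
Proof. by case=> x a; apply: (congr2 pair); apply: addNr. Qed.

Lemma z4sd_Vmul : right_inverse z4sd_one z4sd_inv z4sd_mul.
Proof.
case=> x a; apply: (congr2 pair); first exact: subrr.
by rewrite z4actNr -z4actD [(x - x)%R]subrr z4act0; apply: subrr.
Qed.

HB.instance Definition _ := isGroup.Build z4sdprod
  z4sd_mulA z4sd_mul1 z4sd_1mul z4sd_mulV z4sd_Vmul.

Lemma z4sd_central (a : A) : (a + a = 0)%R ->
  forall u : z4sdprod, commute ((2%R, a) : z4sdprod) u.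
Proof.
move=> aa [x b]; have Na : (- a = a)%R by apply/eqP; rewrite eq_sym -addr_eq0 aa.
have z2 : z4act 2%R b = b by [].
have xa : z4act x a = a.
  rewrite /z4act -signr_odd; case: (odd x); last by rewrite expr0.
  by rewrite expr1 mulrN1z.
apply: (congr2 pair); first exact: addrC.
by rewrite z2 [in RHS]xa; apply: addrC.
Qed.

End Z4Semidirect.

Section QuaternionLike.
Variables l k : nat.

(* ['Z_(2 ^ k)] is the integers modulo 2 ^ k only for k >= 1. *)
Definition ql_base : zmodType := ('rV[int]_l * 'Z_(2 ^ k))%type.

Definition ql_torsion : ql_base := (0%R, ((2 ^ k.-1)%N%:R)%R).

Definition ql_elt : z4sdprod ql_base := (2%R, ql_torsion).

Lemma ql_torsion2 : (ql_torsion + ql_torsion = 0)%R.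
Proof.
apply: (congr2 pair); first exact: addr0.
rewrite -natrD addnn -mul2n -expnS; case: k => [|k'] /=; first exact/val_inj.
by rewrite pchar_Zp // (ltn_exp2l 0).
Qed.

Definition ql_group : groupType :=
  quot_normal (gspan_central_normal (z4sd_central ql_torsion2)).

End QuaternionLike.

(* Elements of the free group of rank m are represented by reduced words; a
   letter (i, b) is the i-th free generator if b is false and its inverse if b
   is true, so that word length is the size of the reduced word. *)
Definition free_word (m : nat) : Type :=
  {w : seq ('I_m * bool) | sorted (fun a b => b != (a.1, ~~ a.2)) w}.

Definition word_eval (G : groupType) m (S : m.-tuple G) (w : free_word m) : G :=
  \prod_(a <- sval w) (if a.2 then (tnth S a.1)^-1 else tnth S a.1).

Record marked_group (m : nat) := MarkedGroup {
  mg_group : groupType;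
  mg_gens : m.-tuple mg_group;
  mg_gensP : gspan [set` mg_gens] = setT
}.

Section GromovGrigorchuk.
Variable m : nat.
Implicit Types (X Y : marked_group m) (L : nat).

Definition Rel L X : set (free_word m) :=
  [set w | (size (sval w) <= L)%N /\ word_eval (mg_gens X) w = 1].

Definition max_agreement X Y L : Prop :=
  Rel L X = Rel L Y /\ forall L', Rel L' X = Rel L' Y -> (L' <= L)%N.

(* A pseudometric on representatives; its zero set is the identification of
   isomorphic marked groups. *)
Definition gg_dist (R : realType) X Y : R :=
  if `[< forall L, Rel L X = Rel L Y >] then 0%R
  else expR (- (xget 0%N [set L | max_agreement X Y L])%:R).

End GromovGrigorchuk.

Definition quaternion_limit (R : realType) (G : groupType) : Prop :=
  exists2 m : nat, (1 <= m)%N &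
  exists (S : m.-tuple G) (gS : gspan [set` S] = setT)
         (X : nat -> marked_group m),
    (forall i, quaternion_group (mg_group (X i))) /\
    (fun i => gg_dist R (X i) (MarkedGroup gS)) @ \oo --> (0%R : R).

Definition fully_residually_quaternion (G : groupType) : Prop :=
  forall E : set G, finite_set E ->
  exists2 n : nat, (3 <= n)%N &
  exists alpha : {multiplicative G -> quaternion n}, set_inj E alpha.

Inductive gterm :=
  | GVar of nat
  | GOne
  | GInv of gterm
  | GMul of gterm & gterm.

Inductive gformula :=
  | GEq of gterm & gterm
  | GNot of gformula
  | GAnd of gformula & gformula
  | GOr of gformula & gformula
  | GImp of gformula & gformula
  | GForall of nat & gformula
  | GExists of nat & gformula.

Fixpoint term_vars (t : gterm) : seq nat :=
  match t with
  | GVar i => [:: i]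
  | GOne => [::]
  | GInv t1 => term_vars t1
  | GMul t1 t2 => term_vars t1 ++ term_vars t2
  end.

Fixpoint free_vars (f : gformula) : seq nat :=
  match f with
  | GEq t1 t2 => term_vars t1 ++ term_vars t2
  | GNot f1 => free_vars f1
  | GAnd f1 f2 | GOr f1 f2 | GImp f1 f2 => free_vars f1 ++ free_vars f2
  | GForall i f1 | GExists i f1 => [seq j <- free_vars f1 | j != i]
  end.

Definition sentence (f : gformula) : bool := nilp (free_vars f).

Fixpoint quantifier_free (f : gformula) : bool :=
  match f with
  | GEq _ _ => true
  | GNot f1 => quantifier_free f1
  | GAnd f1 f2 | GOr f1 f2 | GImp f1 f2 =>
      quantifier_free f1 && quantifier_free f2
  | GForall _ _ | GExists _ _ => false
  end.

Fixpoint universal_prenex (f : gformula) : bool :=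
  if f is GForall _ f1 then universal_prenex f1 else quantifier_free f.

(* [baseGroupType] is the class of structures for the language (1, ^-1, * ),
   with no group axiom imposed. *)
Section Semantics.
Variable M : baseGroupType.

Fixpoint term_eval (e : nat -> M) (t : gterm) : M :=
  match t with
  | GVar i => e i
  | GOne => 1
  | GInv t1 => (term_eval e t1)^-1
  | GMul t1 t2 => term_eval e t1 * term_eval e t2
  end.

Definition update (e : nat -> M) (i : nat) (x : M) : nat -> M :=
  fun j => if j == i then x else e j.

Fixpoint holds (e : nat -> M) (f : gformula) : Prop :=
  match f with
  | GEq t1 t2 => term_eval e t1 = term_eval e t2
  | GNot f1 => ~ holds e f1
  | GAnd f1 f2 => holds e f1 /\ holds e f2
  | GOr f1 f2 => holds e f1 \/ holds e f2
  | GImp f1 f2 => holds e f1 -> holds e f2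
  | GForall i f1 => forall x, holds (update e i x) f1
  | GExists i f1 => exists x, holds (update e i x) f1
  end.

End Semantics.

Definition logically_equivalent (f g : gformula) : Prop :=
  forall (M : baseGroupType) (e : nat -> M), holds e f <-> holds e g.

Definition universal_sentence (f : gformula) : Prop :=
  sentence f /\
  exists g, [/\ sentence g, universal_prenex g & logically_equivalent f g].

Definition Th_forall (G : groupType) : set gformula :=
  [set f | universal_sentence f /\ forall e : nat -> G, holds e f].

Section Product.
Variables (I : Type) (G : I -> groupType).

Definition prodg : Type := forall i, G i.

HB.instance Definition _ := gen_eqMixin prodg.
HB.instance Definition _ := gen_choiceMixin prodg.

Definition prodg_mul (x y : prodg) : prodg := fun i => x i * y i.
Definition prodg_one : prodg := fun i => 1.
Definition prodg_inv (x : prodg) : prodg := fun i => (x i)^-1.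

Lemma prodg_mulA : associative prodg_mul.
Proof. by move=> x y z; apply: functional_extensionality_dep => i; apply: mulgA. Qed.
Lemma prodg_mul1 : left_id prodg_one prodg_mul.
Proof. by move=> x; apply: functional_extensionality_dep => i; apply: mul1g. Qed.
Lemma prodg_1mul : right_id prodg_one prodg_mul.
Proof. by move=> x; apply: functional_extensionality_dep => i; apply: mulg1. Qed.
Lemma prodg_mulV : left_inverse prodg_one prodg_inv prodg_mul.
Proof. by move=> x; apply: functional_extensionality_dep => i; apply: mulVg. Qed.
Lemma prodg_Vmul : right_inverse prodg_one prodg_inv prodg_mul.
Proof. by move=> x; apply: functional_extensionality_dep => i; apply: mulgV. Qed.

HB.instance Definition _ := isGroup.Build prodg
  prodg_mulA prodg_mul1 prodg_1mul prodg_mulV prodg_Vmul.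

End Product.

Section Ultraproduct.
Variables (U : set_system nat) (UU : UltraFilter U) (G : nat -> groupType).

Definition ultra_rel (x y : prodg G) : Prop := U [set i | x i = y i].

Lemma ultra_rel_refl x : ultra_rel x x.
Proof. by apply: filterS filterT => i. Qed.

Lemma ultra_rel_sym x y : ultra_rel x y -> ultra_rel y x.
Proof. by apply: filterS => i /= ->. Qed.

Lemma ultra_rel_trans x y z :
  ultra_rel x y -> ultra_rel y z -> ultra_rel x z.
Proof. by apply: filterS2 => i /= -> ->. Qed.

Lemma ultra_relM x x' y y' :
  ultra_rel x x' -> ultra_rel y y' -> ultra_rel (x * y) (x' * y').
Proof.
by apply: filterS2 => i /= xx' yy'; rewrite /mul /= /prodg_mul xx' yy'.
Qed.

Definition ultra_congruence : congruence (prodg G) :=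
  Congruence ultra_rel_refl ultra_rel_sym ultra_rel_trans ultra_relM.

Definition ultraproduct : groupType := quotg ultra_congruence.

End Ultraproduct.

Definition embeds_in_quaternion_ultraproduct (G : groupType) : Prop :=
  exists (U : set_system nat) (UU : UltraFilter U) (H : nat -> groupType),
    (forall i, quaternion_group (H i)) /\ gembeds G (ultraproduct UU H).

(* Main.v *)
Require Import Defs.
From HB Require Import structures.
From mathcomp Require Import all_boot all_order all_algebra.
From mathcomp Require Import fingroup morphism cyclic extremal generic_quotient.
From mathcomp Require Import boolp classical_sets functions cardinality filter.
From mathcomp Require Import reals topology normedtype sequences exp.

(* Conditions 1, 2, 4 and 5 each imply the weak property below, the weak property
   implies condition 3, condition 3 implies the strong property, and the strong
   property implies conditions 1, 2, 4 and 5.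
   - Weak: every finite subset of G embeds in some Q_(2^n) by a map that respects
     the products inside the subset.  An ultrafilter on these partial embeddings
     transfers the universal properties of the pair <x> < Q_(2^n): a non-abelian
     G has an abelian subgroup C of index 2, inverted by its complement, with
     exactly one involution w and no odd torsion, and t^2 = w for t outside C.
     If G is finitely generated so is C, which is then the sum of Z^l and a
     cyclic 2-group containing w, and G is the group of condition 3.
   - Strong: every finite subset of G is mapped injectively by some epimorphism
     G -> Q_(2^n).  For the group of condition 3, send Z^l to Z by a linear form
     that does not vanish on finitely many given vectors, and Z_(2^k) onto the
     subgroup of its order in Z_(2^(n-1)), for n large. *)

Set Implicit Arguments.
Unset Strict Implicit.
Unset Printing Implicit Defensive.
Import Order.TTheory GRing.Theory Num.Theory.
Import numFieldNormedType.Exports.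

Local Open Scope group_scope.

(** * Quaternion groups and local embeddings *)

(** An element outside [<[x]>] has order 4, so its square is the unique involution; the last clause
    holds because the complement of [<[x]>], of index 2, is a single coset. *)
Lemma quaternion_generators n : (2 < n)%N ->
  exists x y : 'Q_(2 ^ n),
    [/\ #[x] = (2 ^ n.-1)%N, y \notin <[x]>,
        forall t, t \notin <[x]> -> t ^+ 2 = x ^+ (2 ^ n.-2),
        forall z t, z \in <[x]> -> t \notin <[x]> -> z ^ t = z^-1
      & forall u v, u \notin <[x]> -> v \notin <[x]> -> u * v \in <[x]> ].
Proof.
move=> n_gt2; set Q := ('Q_(2 ^ n))%type.
have isoQ : [set: Q] \isog [set: 'Q_(2 ^ n)] by exact: isog_refl.
have [[x y] genQ _] := generators_quaternion n_gt2 isoQ.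
have [oQ _ ox /setDP[_ nXy]] := genQ.
have [[_ ord4 invX] _ [_ _ invol _ _] _ _] := quaternion_structure n_gt2 genQ isoQ.
exists x, y; split=> // [t nXt | z t Xz nXt | u v nXu nXv].
- by apply: invol; rewrite ?inE // orderXdiv ord4 ?inE ?nXt.
- by apply: (invX z t) => //; rewrite !inE nXt.
have iX : #|[set: Q]%G : <[x]>| = 2.
  rewrite -divgS; last exact: finset.subsetT.
  rewrite -orderE ox [X in (X %/ _)%N]oQ.
  by rewrite -[n in (2 ^ n)%N](@prednK n) ?expnS ?mulnK ?expn_gt0 //; case: (n) n_gt2.
have rc t : t \notin <[x]> -> <[x]> :* t = [set: Q] :\: <[x]>.
  by move=> nXt; apply: rcoset_index2; rewrite ?finset.subsetT // !inE nXt.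
have : v^-1 \in <[x]> :* u by rewrite rc // !inE groupV nXv.
rewrite mem_rcoset => Xuv; rewrite -groupV invMg //.
Qed.

(** The model is [<[x]>] in a quaternion group with its involution. Once [C] and [w] are named,
    every clause is universal, so it passes through an ultrafilter. [C] may be all of [G]; an
    element outside it comes from non-commutativity. *)
Definition index2_inverted (G : groupType) (C : set G) (w : G) : Prop :=
  [/\ subgroup C,
      forall u v, C u -> C v -> commute u v,
      forall u v, ~ C u -> ~ C v -> C (u * v)
    & forall z t, C z -> ~ C t -> z ^ t = z^-1] /\
  [/\ w <> 1, w ^+ 2 = 1,
      forall t, ~ C t -> t ^+ 2 = w,
      forall z, C z -> z ^+ 2 = 1 -> z = 1 \/ z = w
    & forall z m, C z -> odd m -> z ^+ m = 1 -> z = 1].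

Lemma quaternion_index2_inverted n : (2 < n)%N ->
  exists (C : set (quaternion n)) (w : quaternion n), index2_inverted C w.
Proof.
move=> n_gt2; have [x [y [ox nXy sqX' invX mulX']]] := quaternion_generators n_gt2.
have n2E : n.-1 = n.-2.+1 by case: (n) n_gt2 => [|[]].
have wNe1 : x ^+ (2 ^ n.-2) <> 1.
  move/eqP; rewrite -order_dvdn ox => /dvdn_leq; rewrite expn_gt0 => /(_ isT).
  by rewrite n2E leq_exp2l // ltnn.
have w2 : x ^+ (2 ^ n.-2) ^+ 2 = 1.
  by rewrite -expgM -expnSr -n2E -ox expg_order.
exists (fun z => z \in <[x]>), (x ^+ (2 ^ n.-2)); split; split => //=.
- by split=> [|u v|u] /=; [exact: group1 | exact: groupM | rewrite groupV].
- by move=> u v /cycleP[i ->] /cycleP[j ->]; apply: commuteX2.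
- by move=> u v /negP nXu /negP nXv; exact: mulX'.
- by move=> z t Xz /negP nXt; exact: invX.
- by move=> t /negP; exact: sqX'.
(* The exponent [i] must be a multiple of [2 ^ n.-2], so the element is a power of the involution,
   and the parity of the quotient decides which one. *)
- move=> _ /cycleP[i ->] /eqP; rewrite -expgM -order_dvdn ox n2E expnSr.
  rewrite dvdn_pmul2r // => /dvdnP[j ->]; rewrite mulnC expgM -(odd_double_half j).
  rewrite expgD -mul2n expgM w2 expg1n mulg1.
  by case: (odd j); [right | left].
- move=> _ m /cycleP[i ->] odd_m /eqP; rewrite -expgM -order_dvdn ox.
  rewrite Gauss_dvdl ?coprimeXl ?coprime2n //.
  by rewrite -ox order_dvdn => /eqP.
Qed.

Local Open Scope classical_set_scope.

(** This is the weak property. As [f] is total, multiplicativity on [E] also governs its values at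
    products that leave [E]. *)
Definition locally_quaternion (G : groupType) : Prop :=
  forall E : seq G, exists2 n : nat, (2 < n)%N &
  exists f : G -> quaternion n,
    {in E &, injective f} /\ {in E &, {morph f : x y / x * y}}.

Lemma locally_quaternion_index2 (G : groupType) :
  locally_quaternion G -> nonabelian G ->
  exists (C : set G) (w t : G), index2_inverted C w /\ ~ C t.
Proof.
move=> lqG Gna.
(* A point carries a map together with a subset and an element of its target, so that the
   ultrafilter can compare all three at once. *)
pose I := {n : nat & ((G -> quaternion n) * set (quaternion n) * quaternion n)%type}.
pose good (E : seq G) : set I := [set p | let f := (projT2 p).1.1 in
  [/\ {in E &, injective f}, {in E &, {morph f : x y / x * y}}
    & index2_inverted (projT2 p).1.2 (projT2 p).2]].
have goodS E1 E2 : {subset E1 <= E2} -> good E2 `<=` good E1.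
  move=> sE p [fI fM iC]; split=> // x y /sE Ex /sE Ey; first exact: fI.
  exact: fM.
have FF : ProperFilter (filter_from setT good).
  apply: filter_from_proper; last first.
    move=> E _; have [n n_gt2 [f [fI fM]]] := lqG E.
    have [C [w iC]] := quaternion_index2_inverted n_gt2.
    by exists (existT _ n (f, C, w)).
  apply: filter_from_filter; first by exists [::].
  move=> E1 E2 _ _; exists (E1 ++ E2) => // p gp.
  by split; apply: goodS gp => x; rewrite mem_cat => ->; rewrite ?orbT.
have [U [UU sFU]] := ultraFilterLemma FF.
have Ugood E : U (good E) by apply: sFU; exists E.
pose F (p : I) : G -> quaternion (projT1 p) := (projT2 p).1.1.
pose D (p : I) : set (quaternion (projT1 p)) := (projT2 p).1.2.
pose W (p : I) : quaternion (projT1 p) := (projT2 p).2.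
(* Some point where the images agree is also injective on the pair [x], [y]. *)
have FI x y : (\forall p \near U, F p x = F p y) -> x = y.
  move=> Fxy; have [p [Fp [fI _ _]]] := filter_ex (filterI Fxy (Ugood [:: x; y])).
  by apply: fI Fp; rewrite !inE eqxx ?orbT.
have FM x y : \forall p \near U, F p (x * y) = F p x * F p y.
  by apply: filterS (Ugood [:: x; y]) => p [_ fM _]; apply: fM; rewrite !inE eqxx ?orbT.
have DP : \forall p \near U, index2_inverted (D p) (W p).
  by apply: filterS (Ugood [::]) => p [].
have F1 : \forall p \near U, F p 1 = 1.
  near=> p; apply: (mulIg (F p 1)); rewrite mul1g.
  have -> : F p 1 * F p 1 = F p (1 * 1) by near: p; apply: filterS (FM 1 1) => p ->.
  by rewrite mulg1.
have FV x : \forall p \near U, F p x^-1 = (F p x)^-1.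
  near=> p; apply: (mulgI (F p x)); rewrite mulgV.
  have <- : F p (x / x) = F p x * F p x^-1 by near: p; exact: FM.
  by rewrite mulgV; near: p.
have FX x m : \forall p \near U, F p (x ^+ m) = F p x ^+ m.
  elim: m => [|m IH]; first exact: F1.
  near=> p; rewrite !expgS.
  by have <- : F p (x ^+ m) = F p x ^+ m; near: p.
pose C : set G := [set x | \forall p \near U, D p (F p x)].
(* Maximality of the ultrafilter: what is not true nearly everywhere is false nearly everywhere.
   Hypotheses of the form [~ C x] transfer only because of this. *)
have nC x : ~ C x -> \forall p \near U, ~ D p (F p x).
  by move=> nCx; have [|//] := in_ultra_setVsetC [set p | D p (F p x)] UU.
have CA u v : C u -> C v -> commute u v.
  move=> Cu Cv; apply: FI; near=> p.
  have -> : F p (u * v) = F p u * F p v by near: p; exact: FM.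
  have -> : F p (v * u) = F p v * F p u by near: p; exact: FM.
  have [[_ DA _ _] _] : index2_inverted (D p) (W p) by near: p.
  by apply: DA; near: p.
have [t nCt] : exists t, ~ C t.
  apply/not_existsP => allC; apply: Gna => u v.
  by apply: CA; apply: contrapT; exact: allC.
(* All squares of elements outside [C] have the same image nearly everywhere, hence coincide;
   [t ^+ 2] can therefore serve as [w]. *)
have FW u : ~ C u -> \forall p \near U, F p (u ^+ 2) = W p.
  move=> /nC nCu; near=> p.
  have -> : F p (u ^+ 2) = F p u ^+ 2 by near: p; exact: FX.
  have [_ [_ _ D2 _ _]] : index2_inverted (D p) (W p) by near: p.
  by apply: D2; near: p.
have Fw := FW _ nCt.
exists C, (t ^+ 2), t; split=> //; split; split => //.
- split=> [|u v Cu Cv|u Cu]; rewrite /C /=; near=> p.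
  + have -> : F p 1 = 1 by near: p.
    by have [[[]]] : index2_inverted (D p) (W p) by near: p.
  + have -> : F p (u * v) = F p u * F p v by near: p; exact: FM.
    have [[[_ DM _] _ _ _] _] : index2_inverted (D p) (W p) by near: p.
    by apply: DM; near: p.
  + have -> : F p u^-1 = (F p u)^-1 by near: p; exact: FV.
    have [[[_ _ DV] _ _ _] _] : index2_inverted (D p) (W p) by near: p.
    by apply: DV; near: p.
- move=> u v /nC nCu /nC nCv; rewrite /C /=; near=> p.
  have -> : F p (u * v) = F p u * F p v by near: p; exact: FM.
  have [[_ _ DD _] _] : index2_inverted (D p) (W p) by near: p.
  by apply: DD; near: p.
- move=> z u Cz /nC nCu; apply: (mulgI u); rewrite -conjgC; apply: FI; near=> p.
  have -> : F p (z * u) = F p z * F p u by near: p; exact: FM.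
  have -> : F p (u * z^-1) = F p u * F p z^-1 by near: p; exact: FM.
  have -> : F p z^-1 = (F p z)^-1 by near: p; exact: FV.
  have [[_ _ _ DJ] _] : index2_inverted (D p) (W p) by near: p.
  by rewrite -(DJ _ (F p u)) -?conjgC //; near: p.
- move=> w1; have [p [] ] := filter_ex (filterI DP (filterI F1 Fw)).
  by move=> [_ [W1 _ _ _ _]] [Fp1 Fpw]; apply: W1; rewrite -Fpw w1.
- apply: FI; near=> p.
  have -> : F p (t ^+ 2 ^+ 2) = F p (t ^+ 2) ^+ 2 by near: p; exact: FX.
  have -> : F p 1 = 1 by near: p.
  have -> : F p (t ^+ 2) = W p by near: p.
  by have [_ [_ W2 _ _ _]] : index2_inverted (D p) (W p) by near: p.
- move=> u nCu; apply: FI; near=> p.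
  have -> : F p (t ^+ 2) = W p by near: p.
  by near: p; exact: FW.
- move=> z Cz z2.
  (* The alternative may vary with the point; the ultrafilter selects one side. *)
  have [z1|zn1] := in_ultra_setVsetC [set p | F p z = 1] UU.
    left; apply: FI; near=> p.
    have -> : F p 1 = 1 by near: p.
    by near: p.
  right; apply: FI; near=> p.
  have -> : F p (t ^+ 2) = W p by near: p.
  have [_ [_ _ _ DI _]] : index2_inverted (D p) (W p) by near: p.
  have [||nz1|//] := DI (F p z); first by near: p.
    have <- : F p (z ^+ 2) = F p z ^+ 2 by near: p; exact: FX.
    by rewrite z2; near: p.
  by have : F p z <> 1 by near: p.
- move=> z m Cz odd_m zm; apply: FI; near=> p.
  have -> : F p 1 = 1 by near: p.
  have [_ [_ _ _ _ DO]] : index2_inverted (D p) (W p) by near: p.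
  apply: (DO _ m) => //; first by near: p.
  have <- : F p (z ^+ m) = F p z ^+ m by near: p; exact: FX.
  by rewrite zm; near: p.
Unshelve. all: by end_near.
Qed.

(** * Abelian groups with a single involution *)

Section AbelianOneInvolution.
Local Open Scope ring_scope.
Variables (A : zmodType) (w : A).
Hypotheses (w_neq0 : w <> 0) (w2 : w *+ 2 = 0).
Hypothesis involution_uniq : forall z : A, z *+ 2 = 0 -> z = 0 \/ z = w.
Hypothesis no_odd_torsion : forall (z : A) m, odd m -> z *+ m = 0 -> z = 0.

Lemma torsion_pow2 (z : A) m : (0 < m)%N -> z *+ m = 0 ->
  exists2 q, (2 ^ q %| m)%N & z *+ (2 ^ q) = 0.
Proof.
move=> m_gt0 zm; have [d d_odd dE] := pfactor_coprime (isT : prime 2) m_gt0.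
exists (logn 2 m); first by rewrite [X in (_ %| X)%N]dE dvdn_mull.
apply: (@no_odd_torsion _ d); first by rewrite -coprime2n.
by rewrite -mulrnA mulnC -dE.
Qed.

(** Repeated doubling of [z] reaches 0, and the last nonzero term is an involution. *)
Lemma torsion_root_of_involution (z : A) m : z <> 0 -> (0 < m)%N -> z *+ m = 0 ->
  exists q, z *+ (2 ^ q) = w.
Proof.
move=> z0 m_gt0 /(torsion_pow2 m_gt0)[q _]; elim: q => [|q IH].
  by rewrite expn0 mulr1n.
by rewrite expnSr mulrnA => /involution_uniq[/IH //|]; exists q.
Qed.

(** Induction on [q]: if half of the exponent does not kill [a], it sends [a] to [w], and
    subtracting a multiple of [t] with the same image lowers the order. *)
Lemma pow2_torsion_cyclic (t a : A) p q : t *+ (2 ^ p) = w -> (q <= p.+1)%N ->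
  a *+ (2 ^ q) = 0 -> exists c, a = t *+ c.
Proof.
move=> tw; elim: q a => [|q IH] a le_qp.
  by rewrite expn0 mulr1n => ->; exists 0%N; rewrite mulr0n.
rewrite expnSr mulrnA => /involution_uniq[/IH|aw]; first by apply; apply: ltnW.
have [|c ac] := IH (a - t *+ 2 ^ (p - q)) (ltnW le_qp).
  by rewrite mulrnBl aw -mulrnA -expnD subnK // tw subrr.
by exists (c + 2 ^ (p - q))%N; rewrite mulrnDr -ac subrK.
Qed.

(** Of two nonzero torsion elements, the one of larger order generates the other. *)
Lemma torsion_common_root (t a : A) p m : t *+ (2 ^ p) = w ->
  (0 < m)%N -> a *+ m = 0 ->
  exists t' p', t' *+ (2 ^ p') = w /\ exists c d, t = t' *+ c /\ a = t' *+ d.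
Proof.
move=> tw m_gt0 am; have [->|/eqP a0] := eqVneq a 0.
  by exists t, p; split=> //; exists 1%N, 0%N; rewrite mulr1n mulr0n.
have [q aw] := torsion_root_of_involution a0 m_gt0 am.
have [le_qp|/ltnW le_pq] := leqP q p.
  exists t, p; split=> //; exists 1%N.
  have [|c ac] := @pow2_torsion_cyclic t a p q.+1 tw le_qp.
    by rewrite expnSr mulrnA aw.
  by exists c; rewrite mulr1n.
exists a, q; split=> //.
have [|c tc] := @pow2_torsion_cyclic a t q p.+1 aw le_pq.
  by rewrite expnSr mulrnA tw.
by exists c, 1%N; rewrite mulr1n.
Qed.

(** The order of [t] is a power of 2, and it exceeds [2 ^ p] since [w] is nonzero. *)
Lemma root_mulrn_eq0 (t : A) p d : t *+ (2 ^ p) = w -> t *+ d = 0 ->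
  (2 ^ p.+1 %| d)%N.
Proof.
case: d => [|d] // tw /(torsion_pow2 (ltn0Sn d))[q q_d tq]; apply: dvdn_trans q_d.
have [lt_pq|le_qp] := ltnP p q; first by rewrite dvdn_exp2l.
by case: w_neq0; rewrite -tw -(subnKC le_qp) expnD mulrnA tq mul0rn.
Qed.

Definition spanned_by l (f : {additive 'rV[int]_l -> A}) (t : A) : Prop :=
  forall z, exists c j, z = f c + t *~ j.

(* By Smith normal form a unimodular change of basis turns a relation between
   the generators into a multiple of the first one, which is then torsion. *)
Lemma relation_drop_generator l (f : {additive 'rV[int]_l -> A}) t p c m :
  t *+ (2 ^ p) = w -> spanned_by f t -> c != 0 -> (0 < m)%N -> f c *+ m = 0 ->
  exists l' (f' : {additive 'rV[int]_l' -> A}) t' p',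
    [/\ (l' < l)%N, t' *+ (2 ^ p') = w & spanned_by f' t'].
Proof.
move=> tw; case: l f c => [|l] f c fS c0 m_gt0 fcm.
  by rewrite thinmx0 eqxx in c0.
have [L _ [R Ru [d _ cE]]] := int_Smith_normal_form c.
pose e0 : 'rV[int]_(1 + l) := row_mx 1%:M 0.
(* For a single row, the left factor of the Smith form is a scalar and the diagonal has one
   entry. *)
pose s : int := L 0 0 * d`_0.
have cs : c = (e0 *~ s) *m R.
  rewrite cE; congr (_ *m _); apply/rowP => j.
  rewrite !mxE big_ord1 -scaler_int !mxE /s.
  case: (@split_ordP 1 l j) => i -> /=; rewrite ?mxE.
    by rewrite !ord1 /= mulr1n mulr1 intz.
  by rewrite mulr0n !mulr0.
have s0 : s != 0 by apply: contraNneq c0 => s0; rewrite cs s0 mulr0z mul0mx.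
(* The rows of [R] are the new basis; [f1] keeps all of them but the first. *)
pose f1 (u : 'rV[int]_l) := f ((row_mx 0 u : 'rV_(1 + l)) *m R).
have f1A : zmod_morphism f1.
  move=> u v; rewrite /f1 -raddfB -mulmxBl; congr (f (_ *m _)).
  by rewrite opp_row_mx add_row_mx subr0.
pose f' : {additive 'rV[int]_l -> A} :=
  HB.pack f1 (GRing.isZmodMorphism.Build _ _ f1 f1A).
(* The image of the first basis vector is killed by [s] times [m], so it can be merged with [t] into
   a single torsion generator. *)
pose a := f (e0 *m R).
have am : a *+ (`|s| * m)%N = 0.
  have : a *~ s *+ m = 0 by rewrite -raddfMz -[X in f X](raddfMz (mulmxr R)) /= -cs.
  rewrite mulrnA; case: (s) => n //= /eqP.
  by rewrite [a *~ _]/(a *- n.+1) mulNrn oppr_eq0 => /eqP.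
have [|t' [p' [tw' [i [j [ti aj]]]]]] := torsion_common_root tw _ am.
  by rewrite muln_gt0 m_gt0 lt0n absz_eq0 s0.
exists l, f', t', p'; split=> // z; have [b [k zE]] := fS z.
(* Coordinates in the new basis: the first one is absorbed by [t'], the others are passed to
   [f']. *)
pose v : 'rV[int]_(1 + l) := b *m invmx R.
exists (rsubmx v), (lsubmx v 0 0 * j%:Z + k * i%:Z).
have bE : b = (e0 *~ lsubmx v 0 0 + row_mx 0 (rsubmx v)) *m R.
  rewrite -[LHS](mulmxKV Ru) -/v -[v in LHS]hsubmxK; congr (_ *m _).
  apply/rowP => x; rewrite !mxE -scaler_int !mxE.
  by case: (@split_ordP 1 l x) => y xE /=;
    rewrite ?mxE ?ord1 ?intz ?mulr1 ?mulr0 ?addr0 ?add0r.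
rewrite zE {1}bE mulmxDl raddfD -addrA addrC -addrA; congr (_ + _).
have -> : f ((e0 *~ lsubmx v 0 0) *m R) = a *~ lsubmx v 0 0.
  by rewrite -raddfMz; congr (f _); exact: (raddfMz (mulmxr R)).
by rewrite ti aj !pmulrn -!mulrzA -mulrzDr addrC (mulrC k) (mulrC (lsubmx _ _ _)).
Qed.

Lemma minimal_generators l (f : {additive 'rV[int]_l -> A}) t p :
  t *+ (2 ^ p) = w -> spanned_by f t ->
  exists l' (f' : {additive 'rV[int]_l' -> A}) t' p',
    [/\ t' *+ (2 ^ p') = w, spanned_by f' t'
      & forall c m, (0 < m)%N -> f' c *+ m = 0 -> c = 0].
Proof.
elim/ltn_ind: l f t p => l IH f t p tw fS.
have [free_f|] := pselect (forall c m, (0 < m)%N -> f c *+ m = 0 -> c = 0).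
  by exists l, f, t, p.
move=> /existsNP[c /existsNP[m /not_implyP[m_gt0 /not_implyP[fcm /eqP c0]]]].
have [l' [f' [t' [p' [lt_l tw' fS']]]]] :=
  relation_drop_generator tw fS c0 m_gt0 fcm.
exact: IH lt_l _ _ _ tw' fS'.
Qed.

Lemma Zpow2_mulrnD (t : A) k (x y : 'Z_(2 ^ k)) : (0 < k)%N ->
  t *+ (2 ^ k) = 0 -> t *+ (x + y)%R = t *+ x + t *+ y.
Proof.
move=> k_gt0 tk; rewrite -mulrnDr [in RHS](divn_eq (x + y) (2 ^ k)).
rewrite mulrnDr mulnC mulrnA tk mul0rn add0r /= [X in (_ %% X)%N]Zp_cast //.
by rewrite (ltn_exp2l 0).
Qed.

(** The descent starts from [w] as its own root. In the result [t] has order [2 ^ p.+1] and the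
    other generators are independent modulo torsion, which gives the direct sum with [k = p.+1]. *)
Lemma ql_base_iso l (f : {additive 'rV[int]_l -> A}) : (forall z, exists c, z = f c) ->
  exists l' k (psi : {additive ql_base l' k -> A}),
    [/\ (0 < k)%N, bijective psi & psi (ql_torsion l' k) = w].
Proof.
move=> fS.
have w1 : w *+ (2 ^ 0) = w by rewrite expn0 mulr1n.
have [|l' [g [t [p [tw gS gI]]]]] := @minimal_generators l f w 0%N w1.
  by move=> z; have [c ->] := fS z; exists c, 0; rewrite mulr0z addr0.
have pow_gt1 : (1 < 2 ^ p.+1)%N by rewrite (ltn_exp2l 0).
have tk : t *+ (2 ^ p.+1) = 0 by rewrite expnSr mulrnA tw.
pose h (u : ql_base l' p.+1) := g u.1 + t *+ u.2.
have hA : zmod_morphism h.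
  suff hD u v : h (u + v) = h u + h v.
    by move=> u v; apply/eqP; rewrite eq_sym subr_eq -hD subrK.
  by rewrite /h raddfD Zpow2_mulrnD // addrACA.
pose psi : {additive ql_base l' p.+1 -> A} :=
  HB.pack h (GRing.isZmodMorphism.Build _ _ h hA).
exists l', p.+1, psi; split=> //.
  have psiI : injective psi.
    apply: raddf_inj => -[c x]; rewrite /psi /= /h /= => gt0.
    (* Multiplication by [2 ^ p.+1] kills the multiple of [t] and leaves a torsion value of [g]. *)
    have c0 : c = 0.
      apply: (gI c (2 ^ p.+1)%N); first by rewrite expn_gt0.
      move/(congr1 (fun z => z *+ (2 ^ p.+1))): gt0.
      by rewrite mulrnDl -!mulrnA mulnC (mulrnA t) tk mul0rn addr0 mul0rn.
    move: gt0; rewrite c0 raddf0 add0r => /(root_mulrn_eq0 tw).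
    case: x => x /= x_lt /dvdnP[q xE]; congr pair; apply/val_inj => /=.
    rewrite Zp_cast // in x_lt; move: x_lt; rewrite xE.
    by case: q {xE} => [|q]; rewrite ?mul0n // mulSn ltnNge leq_addr.
  have psiS z : exists u, psi u == z.
    have [c [j ->]] := gS z.
    exists (c, inZp (`|(j %% (2 ^ p.+1)%N)%Z|)).
    apply/eqP; rewrite /psi /= /h /=; congr (_ + _).
    set n := (2 ^ p.+1)%N in tk pow_gt1 *; set m := `|_|%N.
    have n_gt0 : 0 < n%:Z by rewrite ltz_nat ltnW.
    have mE : m%:Z = (j %% n)%Z by rewrite gez0_abs // modz_ge0 // lt0r_neq0.
    rewrite [X in (_ %% X)%N]Zp_cast // modn_small; last first.
      by rewrite -ltz_nat mE ltz_pmod.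
    rewrite [in RHS](divz_eq j n) mulrzDr mulrC mulrzA -[t *~ n]/(t *+ n).
    by rewrite tk mul0rz add0r -mE.
  exists (fun z => xchoose (psiS z)) => z; last exact/eqP/(xchooseP (psiS z)).
  exact/psiI/eqP/(xchooseP (psiS (psi z))).
rewrite /psi /= /h /ql_torsion /= raddf0 add0r -[RHS]tw; congr (_ *+ _).
by rewrite val_Zp_nat // modn_small // ltn_exp2l.
Qed.
End AbelianOneInvolution.

(** * Homomorphisms out of the groups of condition 3 *)

Lemma inj_surj_bijective (T T' : choiceType) (f : T -> T') :
  injective f -> (forall y, exists x, f x = y) -> bijective f.
Proof.
move=> fI fS; have fS' y : exists x, f x == y by have [x <-] := fS y; exists x.
exists (fun y => xchoose (fS' y)) => x; last exact/eqP/(xchooseP (fS' x)).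
exact/fI/eqP/(xchooseP (fS' (f x))).
Qed.

Section Multiplicative.
Variables (G H : groupType) (f : {multiplicative G -> H}).

Lemma multiplicative1 : f 1 = 1.
Proof. by apply: (mulgI (f 1)); rewrite -gmulfM !mulg1. Qed.

(** Between groups a multiplicative map preserves 1; this packaging gives access to the lemmas on
    unital morphisms. *)
Let f' : UMagmaMorphism.type G H :=
  HB.pack (Multiplicative.sort f) f
    (Multiplicative_isUMagmaMorphism.Build G H f multiplicative1).

Lemma multiplicativeV : {morph f : x / x^-1}.
Proof. exact: (gmulfV f'). Qed.

Lemma multiplicative_prod I r (P : pred I) E :
  f (\prod_(i <- r | P i) E i) = \prod_(i <- r | P i) f (E i).
Proof. exact: (gmulf_prod f'). Qed.

Lemma multiplicative_inj : (forall x, f x = 1 -> x = 1) -> injective f.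
Proof. exact: (@gmulf_inj _ _ f'). Qed.

End Multiplicative.

Lemma gisomorphic_sym (G H : groupType) : gisomorphic G H -> gisomorphic H G.
Proof.
move=> [f [g fK gK]].
have gM : {morph g : x y / x * y} by apply: (can2_gmulfM fK gK).
pose g' : {multiplicative H -> G} := HB.pack g (isMultiplicative.Build _ _ g gM).
by exists g', f.
Qed.

Lemma gspan_id (G : groupType) (A : set G) x : A x -> gspan A x.
Proof. by move=> Ax H [_]; apply. Qed.

Lemma gspan_min (G : groupType) (A H : set G) :
  subgroup H -> A `<=` H -> gspan A `<=` H.
Proof. by move=> sgH sAH x; apply. Qed.

Lemma gspan_subgroup (G : groupType) (A : set G) : subgroup (gspan A).
Proof.
split=> [|x y Ax Ay|x Ax] H [sgH AH]; have [H1 HM HV] := sgH => //.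
  by apply: HM; [apply: Ax | apply: Ay].
by apply: HV; apply: Ax.
Qed.

Lemma preimage_subgroup (G H : groupType) (f : {multiplicative G -> H}) (B : set H) :
  subgroup B -> subgroup (f @^-1` B).
Proof.
move=> [B1 BM BV]; split; rewrite /preimage /=; first by rewrite multiplicative1.
  by move=> x y Bx By; rewrite gmulfM; exact: BM.
by move=> x Bx; rewrite multiplicativeV; exact: BV.
Qed.

Lemma set1_subgroup (G : groupType) : subgroup [set (1 : G)].
Proof. by split=> [|_ _ -> ->|_ ->] //=; rewrite ?mulg1 ?invg1. Qed.

Lemma range_subgroup (G H : groupType) (f : {multiplicative G -> H}) :
  subgroup (range f).
Proof.
split; first by exists 1 => //; rewrite multiplicative1.
  by move=> _ _ [x _ <-] [y _ <-]; exists (x * y) => //; rewrite gmulfM.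
by move=> _ [x _ <-]; exists x^-1 => //; rewrite multiplicativeV.
Qed.

Section QuotientLift.
Variables (G H : groupType) (N : set G) (nN : normal_subgroup N).
Variables (f : {multiplicative G -> H}).

Lemma quot_normal_lift : (forall x, N x -> f x = 1) ->
  exists g : {multiplicative quot_normal nN -> H},
    forall x, g (quotg_pi (coset_congruence nN) x) = f x.
Proof.
move=> fN; pose g (u : quot_normal nN) := f (repr u).
have gE x : g (quotg_pi (coset_congruence nN) x) = f x.
  have /fN := quotg_repr_pi (coset_congruence nN) x.
  by rewrite gmulfM multiplicativeV => /mulg1_eq; rewrite invgK.
have gM : {morph g : u v / u * v}.
  move=> u v; rewrite -(quotg_pi_repr u) -(quotg_pi_repr v) -quotg_pi_morph !gE.
  exact: gmulfM.
pose g' : {multiplicative quot_normal nN -> H} :=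
  HB.pack g (isMultiplicative.Build _ _ g gM).
by exists g'.
Qed.

Lemma quot_normal_gisomorphic : (forall x, f x = 1 <-> N x) ->
  (forall y, exists x, f x = y) -> gisomorphic (quot_normal nN) H.
Proof.
move=> fN fS; have [|g gE] := quot_normal_lift; first by move=> x /fN.
exists g; apply: inj_surj_bijective => [|y]; last first.
  by have [x <-] := fS y; exists (quotg_pi _ x).
apply: multiplicative_inj => u; rewrite -(quotg_pi_repr u) gE => /fN Nu.
apply/quotg_piP; rewrite /= /coset_rel mulg1.
by have [[_ _ NV] _] := nN; apply: NV.
Qed.

End QuotientLift.

Section Z4Hom.
Variables (A : zmodType) (H : groupType) (psi : A -> H) (t : H).
Hypothesis psiD : forall a b, psi (a + b)%R = psi a * psi b.
Hypothesis psiJ : forall a, psi a ^ t = (psi a)^-1.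
Hypothesis t4 : t ^+ 4 = 1.

Lemma z4_hom0 : psi 0%R = 1.
Proof. by apply: (mulgI (psi 0%R)); rewrite -psiD addr0 mulg1. Qed.

Lemma z4_homN a : psi (- a)%R = (psi a)^-1.
Proof. by apply: (mulgI (psi a)); rewrite -psiD subrr mulgV z4_hom0. Qed.

Lemma z4_hom_conj n a : t ^+ n * psi a = psi (a *~ (-1) ^+ n)%R * t ^+ n.
Proof.
elim: n a => [|n IH] a; first by rewrite expr0 mulr1z mul1g mulg1.
have tV : t * psi a = psi (- a)%R * t.
  by rewrite (conjgC (psi _)) psiJ z4_homN invgK.
by rewrite expgSr -mulgA tV mulgA IH -mulgA exprS mulN1r mulNrz mulrNz.
Qed.

(** The universal property of the semidirect product. The abelian part comes first because a pair
    [(x, a)] stands for the product of [a] by [x]. *)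
Definition z4_hom (u : z4sdprod A) : H := psi u.2 * t ^+ (u.1 : nat).

Lemma z4_homM : {morph z4_hom : u v / u * v}.
Proof.
move=> [x a] [y b]; rewrite /z4_hom /= psiD -!mulgA; congr (_ * _).
rewrite [RHS]mulgA z4_hom_conj -mulgA -expgnDr; congr (_ * _).
(* The sum of the exponents is reduced modulo 4 on one side only; [t4] absorbs the difference. *)
by rewrite [in RHS](divn_eq (x + y) 4) expgnDr mulnC expgnA t4 expg1n mul1g.
Qed.

Definition z4_morphism : {multiplicative z4sdprod A -> H} :=
  HB.pack z4_hom (isMultiplicative.Build _ _ z4_hom z4_homM).

End Z4Hom.


(** * Recovering the group from its inverted subgroup of index 2 *)

Section AbelianSubgroup.
Variables (G : groupType) (C : set G) (sgC : subgroup C).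
Hypothesis abC : forall u v, C u -> C v -> commute u v.

(** Making membership boolean yields a subtype with injective [val]; it is written additively so
    that the results on abelian groups apply. *)
Definition subab : Type := {x : G | `[< C x >]}.
HB.instance Definition _ := Choice.on subab.

Definition in_subab x (Cx : C x) : subab := exist _ x (asboolT Cx).

Lemma subabP (a : subab) : C (val a).
Proof. exact/asboolP/(valP a). Qed.

Definition subab_add (a b : subab) : subab :=
  in_subab (let: And3 _ CM _ := sgC in CM _ _ (subabP a) (subabP b)).
Definition subab_opp (a : subab) : subab :=
  in_subab (let: And3 _ _ CV := sgC in CV _ (subabP a)).
Definition subab_zero : subab := in_subab (let: And3 C1 _ _ := sgC in C1).

Lemma subab_addA : associative subab_add.
Proof. by move=> a b c; apply/val_inj; rewrite /= mulgA. Qed.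
Lemma subab_addC : commutative subab_add.
Proof. by move=> a b; apply/val_inj/abC; exact: subabP. Qed.
Lemma subab_add0 : left_id subab_zero subab_add.
Proof. by move=> a; apply/val_inj; rewrite /= mul1g. Qed.
Lemma subab_addN : left_inverse subab_zero subab_opp subab_add.
Proof. by move=> a; apply/val_inj; rewrite /= mulVg. Qed.

Definition subab_zmodType : zmodType := HB.pack subab
  (GRing.isZmodule.Build subab subab_addA subab_addC subab_add0 subab_addN).

End AbelianSubgroup.

Lemma additive_span (A : zmodType) (s : seq A) :
  exists l (f : {additive 'rV[int]_l -> A}), forall a, a \in s -> exists c, f c = a.
Proof.
pose f (v : 'rV[int]_(size s)) := (\sum_(i < size s) s`_i *~ v 0 i)%R.
have fA : zmod_morphism f.
  move=> u v; rewrite /f -sumrB; apply: eq_bigr => i _.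
  by rewrite !mxE mulrzBr.
pose f' : {additive 'rV[int]_(size s) -> A} :=
  HB.pack f (GRing.isZmodMorphism.Build _ _ f fA).
exists (size s), f' => a /(nthP 0%R)[i i_lt <-].
exists (delta_mx 0 (Ordinal i_lt))%R; rewrite /f' /= /f (bigD1 (Ordinal i_lt)) //=.
rewrite mxE !eqxx big1 ?addr0 // => j /negPf ji.
by rewrite mxE ji andbF mulr0z.
Qed.

(** Every element is in [C] or in its coset by [t]. A first morphism [F] shows that [C] is finitely
    generated, so its structure is known; a second one, [F'], has kernel exactly the central
    subgroup of condition 3. *)
Lemma index2_inverted_ql_group (G : groupType) (C : set G) (w t : G) :
  fin_generated G -> index2_inverted C w -> ~ C t ->
  exists l k : nat, (1 <= k)%N /\ gisomorphic G (ql_group l k).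
Proof.
move=> [S finS genS] [[sgC abC mulnC invC] [w1 w2 sqnC invol odd_tors]] nCt.
have [C1 CM CV] := sgC; have tw : t ^+ 2 = w by exact: sqnC.
have Cw : C w by rewrite -tw; apply: mulnC.
have t4 : t ^+ 4 = 1 by rewrite -[4%N]/(2 * 2)%N expgnA tw.
have nCM u v : C u -> ~ C v -> ~ C (u * v).
  by move=> Cu nCv Cuv; apply: nCv; rewrite -(mulKg u v); apply: CM => //; apply: CV.
have t_even n : ~~ odd n -> t ^+ n = w ^+ n./2.
  by move=> /even_halfK {1}<-; rewrite -mul2n expgnA tw.
have CX u n : C u -> C (u ^+ n).
  by move=> Cu; elim: n => [|n IH] //; rewrite expgS; apply: CM.
have t_odd n : odd n -> ~ C (t ^+ n).
  case: n => [|n] //= n_even; rewrite expgSr; apply: nCM => //.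
  by rewrite t_even //; apply: CX.
pose A := subab_zmodType sgC abC.
pose inC x (Cx : C x) : A := in_subab Cx.
pose v (a : A) : G := val (a : subab C).
have vC a : C (v a) by exact: subabP.
have vI : injective v by exact: val_inj.
have vD a b : v (a + b)%R = v a * v b by [].
have vX a n : v (a *+ n)%R = v a ^+ n.
  by elim: n => [|n IH] //; rewrite mulrS vD IH expgS.
have vJ a : v a ^ t = (v a)^-1 by exact: invC.
have /choice[r rP] x : exists a : A, x = v a \/ x = v a * t.
  have [Cx|nCx] := pselect (C x); first by exists (inC x Cx); left.
  have nCtV : ~ C t^-1 by move=> /CV; rewrite invgK.
  by exists (inC _ (mulnC _ _ nCx nCtV)); right; rewrite /v /= mulgVK.
have /finite_seqP[s sP] := finS.
(* Including [w] puts the even powers of [t] in the image of [f]. *)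
have [l [f fP]] := additive_span (inC w Cw :: map r s).
have vfD a b : v (f (a + b)%R) = v (f a) * v (f b) by rewrite raddfD.
pose F : {multiplicative z4sdprod 'rV[int]_l -> G} :=
  z4_morphism (psi := v \o f) vfD (fun a => vJ (f a)) t4.
have FS x : range F x.
  have : gspan S x by rewrite genS.
  apply: gspan_min; first exact: range_subgroup.
  move=> y; rewrite sP /= => sy; have [|c fc] := fP (r y).
    by rewrite inE map_f ?orbT.
  have [->|->] := rP y; [exists (0%R, c) | exists (1%R, c)] => //=;
    rewrite /F /= /z4_hom /= fc //.
  by rewrite mulg1.
have fS a : exists c, a = f c.
  have [[x c] _ /= Fxc] := FS (v a); have [c' fc'] := fP _ (mem_head _ _).
  have [/t_odd tx|/t_even tx] := boolP (odd x).
    by have := vC a; rewrite -Fxc => /(nCM _ _ (vC (f c)) tx).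
  exists (c + c' *+ x./2)%R; apply: vI.
  by rewrite -Fxc vfD raddfMn fc' vX -tx.
have [||||l' [k [psi [k_gt0 [psi' psiK psi'K] psiw]]]] :=
  @ql_base_iso A (inC w Cw) _ _ _ _ l f fS.
- by move=> /(congr1 v) /= /w1.
- by apply: vI; rewrite vX.
- move=> z /(congr1 v); rewrite vX => /(invol _ (vC z))[z1|zw]; [left|right]; exact: vI.
- move=> z m m_odd /(congr1 v); rewrite vX.
  by move=> /(odd_tors _ _ (vC z) m_odd) z1; apply: vI.
exists l', k; split=> //; apply: gisomorphic_sym.
have vpD a b : v (psi (a + b)%R) = v (psi a) * v (psi b) by rewrite raddfD.
pose F' : {multiplicative z4sdprod (ql_base l' k) -> G} :=
  z4_morphism (psi := v \o psi) vpD (fun a => vJ (psi a)) t4.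
apply: (quot_normal_gisomorphic _ (f := F')) => [u|g].
  split; last first.
    suff : gspan [set ql_elt l' k] `<=` F' @^-1` [set 1] by apply.
    apply: gspan_min; first exact/preimage_subgroup/set1_subgroup.
    by move=> _ ->; rewrite /F' /= /z4_hom /= psiw /v /= [t ^+ _]tw -expg2.
  (* An odd [x] would put the value outside [C]. For [x = 0] the kernel condition gives [a = 0]; for
     [x = 2] it says that [psi a] is the inverse of [w], that is [w]. *)
  case: u => x a; rewrite /F' /= /z4_hom /= => Fxa.
  have [/t_odd tx|x_even] := boolP (odd x).
    by have := C1; rewrite -Fxa => /(nCM _ _ (vC (psi a)) tx).
  have psiI := can_inj psiK; move: Fxa; rewrite t_even //= => Fxa.
  have [x0|x2] : x = 0%R \/ x = 2%R.
    by case: x x_even {Fxa} => [[|[|[|[|?]]]] ?] // _; [left|right]; exact: val_inj.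
  - rewrite x0 (_ : a = 0%R); first by case: (gspan_subgroup [set ql_elt l' k]).
    by apply: psiI; rewrite raddf0; apply: vI; rewrite -[LHS]mulg1 -[RHS]Fxa x0.
  - rewrite x2 (_ : a = ql_torsion l' k); first exact: gspan_id.
    apply: psiI; rewrite psiw; apply: vI; apply: (mulIg w).
    by rewrite -[RHS]expg2 w2 -Fxa x2.
have [[x c] _ <-] := FS g; exists (x, psi' (f c)).
by rewrite /F' /F /= /z4_hom /= psi'K.
Qed.

(** * Separating finite sets by epimorphisms onto quaternion groups *)

Section BaseResidual.
Local Open Scope ring_scope.

Lemma exists_nonroot (p : {poly int}) : p != 0 -> exists K, p.[K] != 0.
Proof.
move=> p0; apply: contrapT => /forallNP all_root.
pose s := [seq i%:Z | i <- iota 0 (size p)].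
have : (size s < size p)%N.
  apply: max_poly_roots => //; last by rewrite map_inj_uniq ?iota_uniq // => i j [].
  by apply/allP => K _; apply/negPn/negP; exact: all_root.
by rewrite size_map size_iota ltnn.
Qed.

(** Read a vector as a polynomial and evaluate at an integer [K] that is a root of none of the
    nonzero polynomials from [D]; the constant polynomial 1 takes the value 1. *)
Lemma nonvanishing_form l (D : seq 'rV[int]_l) :
  exists lam : {additive 'rV[int]_l -> int},
    (forall v, v \in D -> v != 0 -> lam v != 0) /\
    ((0 < l)%N -> exists v, lam v = 1).
Proof.
have P0 : \prod_(v <- D | v != 0) rVpoly v != 0.
  rewrite prodf_seq_neq0; apply/allP => v _; apply/implyP.
  by apply: contraNneq => v0; rewrite -(rVpolyK v) v0 linear0.
have [K PK] := exists_nonroot P0.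
pose lam (v : 'rV[int]_l) := (rVpoly v).[K].
have lamA : zmod_morphism lam.
  by move=> u v; rewrite /lam raddfB hornerD hornerN.
pose lam' : {additive 'rV[int]_l -> int} :=
  HB.pack lam (GRing.isZmodMorphism.Build _ _ lam lamA).
exists lam'; split=> [v vD v0|l_gt0].
  move: PK; rewrite horner_prod prodf_seq_neq0 => /allP/(_ _ vD).
  by rewrite v0.
exists (delta_mx 0 (Ordinal l_gt0)).
by rewrite /lam' /= /lam rVpoly_delta hornerXn expr0.
Qed.

Lemma Zp_natr_eq0 p n : (1 < p)%N -> ((n%:R : 'Z_p) == 0) = (p %| n)%N.
Proof. by move=> p_gt1; rewrite -val_eqE /= val_Zp_nat. Qed.

Lemma Zp_intr_eq0 p (z : int) : (1 < p)%N ->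
  ((z%:~R : 'Z_p) == 0) = (p %| `|z|)%N.
Proof.
move=> p_gt1; case: z => n; first exact: Zp_natr_eq0.
rewrite NegzE mulrNz oppr_eq0 abszN; exact: Zp_natr_eq0.
Qed.

(** With [theta] sending [(v, c)] to [lam v + 2 ^ b * c] modulo [2 ^ (k + b)], a zero value makes
    [2 ^ b] divide [lam v], which is too small unless it vanishes; then [2 ^ k] divides [c]. *)
Lemma ql_base_residual l k (E : seq (ql_base l k)) :
  (0 < k)%N -> (0 < l)%N || (1 < k)%N ->
  exists N (theta : {additive ql_base l k -> 'Z_(2 ^ N)}),
    [/\ (1 < N)%N, theta (ql_torsion l k) = (2 ^ N.-1)%N%:R,
        (exists a, theta a = 1)
      & forall a, a \in E -> theta a = 0 -> a = 0].
Proof.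
move=> k_gt0 lk; have [lam [lamE lam1]] := nonvanishing_form [seq a.1 | a <- E].
(* For [l = 0] the value 1 must come from the cyclic summand, hence [b = 0]; for [l > 0] it comes
   from [lam], and [b > 1] makes [N] large enough. *)
have [b [b_lt b_0 b_gt]] : exists b, [/\ forall a, a \in E -> (`|lam a.1| < 2 ^ b)%N,
    l = 0%N -> b = 0%N & (0 < l)%N -> (1 < b)%N].
  have [l0|l_gt0] := posnP l.
    exists 0%N; split=> // -[v c] _ /=.
    have -> : v = 0 by apply/rowP => i; have := ltn_ord i; rewrite [X in (_ < X)%N]l0.
    by rewrite raddf0.
  exists (\sum_(a <- E) `|lam a.1|).+2; split=> // [a aE|l0]; last by rewrite l0 in l_gt0.
  apply: leq_ltn_trans (ltn_expl _ _) => //; do 2!apply: leqW.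
  by rewrite (big_rem a) //= leq_addr.
pose N := (k + b)%N; have N_gt1 : (1 < N)%N.
  case/orP: lk => [/b_gt b1 | k1]; first by rewrite (leq_trans b1) // leq_addl.
  by rewrite (leq_trans k1) // leq_addr.
have pN : (1 < 2 ^ N)%N by rewrite (ltn_exp2l 0) // ltnW.
pose theta (a : ql_base l k) : 'Z_(2 ^ N) := (lam a.1)%:~R + (2 ^ b)%N%:R *+ a.2.
have theta_k : (2 ^ b)%N%:R *+ (2 ^ k) = 0 :> 'Z_(2 ^ N).
  by apply/eqP; rewrite -mulrnA -expnD addnC Zp_natr_eq0.
have thetaA : zmod_morphism theta.
  suff hD u v : theta (u + v) = theta u + theta v.
    by move=> u v; apply/eqP; rewrite eq_sym subr_eq -hD subrK.
  by rewrite /theta raddfD (Zpow2_mulrnD _ _ k_gt0 theta_k) rmorphD addrACA.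
pose theta' : {additive ql_base l k -> 'Z_(2 ^ N)} :=
  HB.pack theta (GRing.isZmodMorphism.Build _ _ theta thetaA).
have k1 : (1 < 2 ^ k)%N by rewrite (ltn_exp2l 0).
exists N, theta'; rewrite /theta' /=; split=> //.
- rewrite /theta raddf0 mulr0z add0r val_Zp_nat // modn_small; last first.
    by rewrite ltn_exp2l // prednK.
  have -> : N.-1 = (b + k.-1)%N by rewrite /N -{1}(prednK k_gt0) addSn addnC.
  by rewrite expnD mulrnA.
- have [l_gt0|] := boolP (0 < l)%N.
    have [v v1] := lam1 l_gt0; exists (v, 0).
    by rewrite /theta /= v1 addr0.
  rewrite -eqn0Ngt => /eqP/b_0 b0; exists (0, 1); rewrite /theta raddf0 add0r b0.
  by rewrite /= [X in (_ %% X)%N]Zp_cast // modn_small.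
move=> [v c] aE /eqP.
have -> : theta (v, c) = (lam v + (2 ^ b * c)%N%:Z)%:~R.
  by rewrite /theta rmorphD /= -mulr_natr -natrM pmulrn.
rewrite Zp_intr_eq0 // => Ndvd.
have lamv : lam v = 0.
  apply/eqP; rewrite -absz_eq0; apply/negPn/negP; rewrite -lt0n => /dvdn_leq le_lam.
  have /le_lam : (2 ^ b %| `|lam v|)%N.
    have : ((2 ^ b)%N%:Z %| lam v + (2 ^ b * c)%N%:Z)%Z.
      rewrite dvdzE absz_nat; apply: dvdn_trans Ndvd.
      by rewrite dvdn_exp2l // leq_addl.
    by rewrite rpredDr // dvdzE !absz_nat dvdn_mulr.
  by rewrite leqNgt (b_lt _ aE).
have v0 : v = 0.
  apply/eqP; apply/negPn/negP => /(lamE v (map_f fst aE)).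
  by rewrite lamv eqxx.
move: Ndvd; rewrite lamv add0r absz_nat v0 expnD mulnC dvdn_pmul2l ?expn_gt0 //.
move=> kc; congr pair; apply/val_inj => /=; apply/eqP; move: kc (ltn_ord c).
rewrite [X in (_ < X)%N -> _]Zp_cast //; case: (c : nat) => // m /dvdn_leq.
by move=> /(_ isT); rewrite leqNgt => /negPf ->.
Qed.

End BaseResidual.

(** Negation is trivial on the group of order 2, so the action is trivial. This excludes the
    parameters that [ql_base_residual] leaves out. *)
Lemma ql_group_abelian (x y : ql_group 0 1) : commute x y.
Proof.
have act_id (e : 'Z_4) (a : ql_base 0 1) : z4act e a = a.
  have Na : (- a)%R = a.
    case: a => v c; apply: (congr2 pair); first by apply/rowP; case.
    by case: c => [[|[|?]] ?]; apply/val_inj.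
  rewrite /z4act -signr_odd; case: (odd e); last by rewrite expr0 mulr1z.
  by rewrite expr1 mulrN1z.
have mulC (u v : z4sdprod (ql_base 0 1)) : u * v = v * u.
  case: u v => [e a] [e' a']; apply: (congr2 pair); first exact: addrC.
  by rewrite /= !act_id; apply: addrC.
rewrite /commute -(quotg_pi_repr x) -(quotg_pi_repr y) -!quotg_pi_morph.
by rewrite mulC.
Qed.

Lemma ql_group_residual l k (E : seq (ql_group l k)) : (0 < k)%N ->
  nonabelian (ql_group l k) ->
  exists2 n, (2 < n)%N & exists f : {multiplicative ql_group l k -> quaternion n},
    {in E &, injective f} /\ forall y, exists x, f x = y.
Proof.
move=> k_gt0 nab.
have lk : (0 < l)%N || (1 < k)%N.
  apply/negPn/negP; rewrite negb_or -leqNgt leqn0 -leqNgt => /andP[/eqP l0 k_le1].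
  apply: nab; have -> : k = 1%N by apply/eqP; rewrite eqn_leq k_le1.
  by rewrite l0; exact: ql_group_abelian.
(* Injectivity on [E] reduces to the absence of nontrivial kernel elements in [D]. *)
pose D := [seq u * v^-1 | u <- E, v <- E].
pose rp (u : ql_group l k) : z4sdprod (ql_base l k) :=
  repr (u : quotg _).
pose r2 d : ql_base l k := (rp d).2.
(* A representative [(2, a)] is trivial in the quotient when [a] is [ql_torsion], so the translates
   must be separated from 0 as well. *)
pose E0 := [seq r2 d | d <- D] ++ [seq (r2 d + ql_torsion l k)%R | d <- D].
have [N [theta [N_gt1 th_tors [a1 th_a1] thE]]] := ql_base_residual E0 k_gt0 lk.
have n_gt2 : (2 < N.+1)%N by [].
exists N.+1 => //.
have [x [y [ox nXy sqX' invX mulX']]] := quaternion_generators n_gt2.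
rewrite /= in ox sqX'.
pose psi a : quaternion N.+1 := x ^+ (theta a : nat).
have p2N : (1 < 2 ^ N)%N by rewrite (ltn_exp2l 0) // ltnW.
have xN (i : nat) : x ^+ (i %% (2 ^ N)) = x ^+ i.
  by rewrite -ox expg_mod_order.
have psiD a b : psi (a + b)%R = psi a * psi b.
  by rewrite /psi raddfD /= [X in (_ %% X)%N]Zp_cast // xN expgD.
have psiJ a : psi a ^ (y : quaternion _) = (psi a)^-1.
  by apply: invX; rewrite ?mem_cycle.
have y4 : y ^+ 4 = 1.
  rewrite -[4%N]/(2 * 2)%N expgM (sqX' y nXy) -expgM -expnSr.
  by rewrite prednK ?(ltnW N_gt1) // -ox expg_order.
pose F := z4_morphism psiD psiJ y4.
have psi_tors : psi (ql_torsion l k) = x ^+ (2 ^ N.-1).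
  by rewrite /psi th_tors val_Zp_nat // xN.
have psi_inj a : psi a = 1 -> theta a = 0%R.
  move/eqP; rewrite -[_ == _]order_dvdn ox => /dvdnP[q qE].
  apply/val_inj => /=; move: (ltn_ord (theta a)); rewrite qE.
  rewrite [X in (_ < X)%N]Zp_cast //.
  by case: q {qE} => [|q]; rewrite ?mul0n // mulSn ltnNge leq_addr.
have FN u : gspan [set ql_elt l k] u -> F u = 1.
  suff : gspan [set ql_elt l k] `<=` F @^-1` [set 1] by apply.
  apply: gspan_min; first exact/preimage_subgroup/set1_subgroup.
  move=> _ ->; rewrite /F /= /z4_hom /= psi_tors.
  by rewrite -(sqX' y nXy) -expgD y4.
pose nN := gspan_central_normal (z4sd_central (ql_torsion2 l k)).
have [f fE] := quot_normal_lift nN FN.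
(* [F] sends [X i] to [x ^+ i] and [Y] to [y ^+ 3], the inverse of [y]; the images of [X i] and of
   [X i * Y] exhaust the quaternion group. *)
pose X i : z4sdprod (ql_base l k) := (0%R, (a1 *+ i)%R).
pose Y : z4sdprod (ql_base l k) := (3%R, 0%R).
pose pi u : ql_group l k := quotg_pi (coset_congruence nN) u.
exists f; split=> [u v uE vE fuv|z]; last first.
  have Fx i : F (X i) = x ^+ i.
    by rewrite /F /= /z4_hom /= mulg1 /psi raddfMn th_a1 val_Zp_nat // xN.
  have Fy : F Y = y^-1.
    rewrite /F /= /z4_hom /= (z4_hom0 psiD) mul1g.
    by apply: (mulgI y); rewrite mulgV -[RHS]y4 -expgS.
  have [/cycleP[i ->]|nXz] := boolP (z \in <[x]>).
    by exists (pi (X i)); rewrite fE Fx.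
  have /cycleP[i zE] := mulX' _ _ nXz nXy.
  exists (pi (X i * Y)).
  by rewrite fE gmulfM Fx Fy -zE mulgK.
suff d1 : u * v^-1 = 1 by exact: divg1_eq d1.
have fd : f (u * v^-1) = 1 by rewrite gmulfM multiplicativeV fuv mulgV.
have : u * v^-1 \in D by apply/allpairsP; exists (u, v).
move: (u * v^-1) fd => d fd dD.
have [e [a [dE inE0 inE0']]] : exists e a,
    [/\ d = pi (e, a), a \in E0 & (a + ql_torsion l k)%R \in E0].
  exists (rp d).1, (r2 d); split; last 2 first.
  - by rewrite mem_cat (map_f r2).
  - by rewrite mem_cat orbC (map_f (fun d => (r2 d + ql_torsion l k)%R)).
  by rewrite -[LHS]quotg_pi_repr /pi /r2 -surjective_pairing.
have Fea : psi a * y ^+ e = 1 by rewrite -[RHS]fd dE; exact/esym/fE.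
rewrite dE.
(* For odd [e], triviality of the value would put [y] in [<[x]>]. *)
have [e_odd|e_even] := boolP (odd e).
  have Xa : psi a \in <[x]> by exact: mem_cycle.
  case: (negP nXy); rewrite -(groupMl _ (_ : (y ^+ 2) ^+ e./2 \in <[x]>)); last first.
    by rewrite (sqX' y nXy) groupX ?mem_cycle.
  have eE : (e./2.*2).+1 = e :> nat by rewrite -[RHS]odd_double_half e_odd.
  rewrite -expgM -expgSr mul2n eE.
  by rewrite -(groupMl _ Xa) Fea group1.
have [e0|e2] : e = 0%R \/ e = 2%R.
  by case: e e_even {dE Fea} => [[|[|[|[|?]]]] ?] // _; [left|right]; exact: val_inj.
- rewrite e0 (thE a inE0) //; apply: psi_inj.
  by rewrite -[LHS]mulg1 -[RHS]Fea e0.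
- rewrite e2 (_ : a = ql_torsion l k).
    apply/quotg_piP; apply: (coset_rel_sym nN); rewrite /coset_rel.
    by rewrite [X in gspan _ X](_ : _ = ql_elt l k) ?invg1 ?mul1g //; exact: gspan_id.
  apply: (addIr (ql_torsion l k)); rewrite ql_torsion2; apply: thE inE0' _.
  by apply: psi_inj; rewrite psiD psi_tors -(sqX' y nXy) -[RHS]Fea e2.
Qed.

(** * Words and the Gromov-Grigorchuk metric *)

Section Words.
Variable m : nat.
Implicit Types (w : seq ('I_m * bool)).

Definition seq_eval (G : groupType) (S : m.-tuple G) w : G :=
  \prod_(a <- w) (if a.2 then (tnth S a.1)^-1 else tnth S a.1).

Lemma seq_eval_cons (G : groupType) (S : m.-tuple G) a w :
  seq_eval S (a :: w) = (if a.2 then (tnth S a.1)^-1 else tnth S a.1) * seq_eval S w.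
Proof. exact: big_cons. Qed.

Lemma seq_eval_cat (G : groupType) (S : m.-tuple G) w1 w2 :
  seq_eval S (w1 ++ w2) = seq_eval S w1 * seq_eval S w2.
Proof. exact: big_cat. Qed.

Definition inv_seq w := rev [seq (a.1, ~~ a.2) | a <- w].

Lemma seq_evalV (G : groupType) (S : m.-tuple G) w :
  seq_eval S (inv_seq w) = (seq_eval S w)^-1.
Proof.
elim: w => [|a w IH]; first by rewrite /seq_eval !big_nil invg1.
rewrite /inv_seq map_cons rev_cons -cats1 seq_eval_cat IH !seq_eval_cons invgM.
by congr (_ * _); rewrite /seq_eval big_nil mulg1 /=; case: (a.2); rewrite /= ?invgK.
Qed.

Lemma seq_eval_morph (G H : groupType) (f : {multiplicative G -> H})
    (S : m.-tuple G) w : seq_eval (map_tuple f S) w = f (seq_eval S w).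
Proof.
rewrite /seq_eval multiplicative_prod; apply: eq_bigr => a _.
by rewrite tnth_map; case: ifP => // _; rewrite multiplicativeV.
Qed.

(** Letters are added one at a time in front, cancelling against the head when possible. As the
    length does not grow, [Rel] also controls unreduced words. *)
Lemma free_reduction w : exists v : free_word m, (size (sval v) <= size w)%N /\
  forall (G : groupType) (S : m.-tuple G), word_eval S v = seq_eval S w.
Proof.
elim: w => [|a w [[v v_red] /= [v_size vE]]].
  by exists (exist _ [::] isT); split=> // G S; rewrite /word_eval /=.
case: v => [|b v] in v_red v_size vE *.
  exists (exist _ [:: a] isT); split=> // G S.
  by rewrite seq_eval_cons -vE /word_eval /= big_cons.
have [ba|ba] := eqVneq b (a.1, ~~ a.2); last first.
  have v'_red : sorted (fun a b => b != (a.1, ~~ a.2)) [:: a, b & v] by rewrite /= ba.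
  exists (exist _ [:: a, b & v] v'_red); split=> // G S.
  by rewrite seq_eval_cons -vE /word_eval /= [LHS]big_cons.
exists (exist _ v (path_sorted v_red)); split=> [|G S]; first exact/ltnW/ltnW.
rewrite seq_eval_cons -vE /word_eval /= big_cons mulgA ba /=.
by case: (a.2); rewrite /= ?mulgV ?mulVg mul1g.
Qed.

Lemma gspan_seq_eval (G : groupType) (S : m.-tuple G) x :
  gspan [set` S] x <-> exists w, seq_eval S w = x.
Proof.
split=> [|[w <-]].
  suff : gspan [set` S] `<=` [set x | exists w, seq_eval S w = x] by apply.
  apply: gspan_min; first split.
  - by exists [::]; rewrite /seq_eval big_nil.
  - by move=> _ _ [w1 <-] [w2 <-]; exists (w1 ++ w2); rewrite seq_eval_cat.
  - by move=> _ [w <-]; exists (inv_seq w); rewrite seq_evalV.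
  move=> y /= /tnthP[i ->]; exists [:: (i, false)].
  by rewrite seq_eval_cons /seq_eval big_nil mulg1.
have [S1 SM SV] := gspan_subgroup [set` S].
elim: w => [|a w IH]; first by rewrite /seq_eval big_nil.
rewrite seq_eval_cons; apply: SM => //.
have Sa : gspan [set` S] (tnth S a.1) by apply: gspan_id; exact: mem_tnth.
by case: ifP => // _; exact: SV.
Qed.

Definition word_ball L : seq (seq ('I_m * bool)) :=
  flatten [seq [seq tval t | t <- enum {: n.-tuple ('I_m * bool)}] | n <- iota 0 L.+1].

Lemma mem_word_ball L w : (size w <= L)%N -> w \in word_ball L.
Proof.
move=> w_le; apply/flatten_mapP; exists (size w); first by rewrite mem_iota.
by apply/mapP; exists (in_tuple w); rewrite ?mem_enum.
Qed.

Lemma RelS (X Y : marked_group m) L L' : (L <= L')%N ->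
  Rel L' X = Rel L' Y -> Rel L X = Rel L Y.
Proof.
move=> le_L eqR; have RelE Z : Rel L Z = Rel L' Z `&` [set w | (size (sval w) <= L)%N].
  apply/seteqP; split=> w /= [ws wz]; last by split=> //; case: ws.
  by split=> //; split=> //; exact: leq_trans le_L.
by rewrite !RelE eqR.
Qed.

Lemma gg_dist_agree (R : realType) (X Y : marked_group m) L :
  (gg_dist R X Y < expR (- L%:R))%R -> Rel L X = Rel L Y.
Proof.
rewrite /gg_dist; case: asboolP => // _; rewrite ltr_expR ltrN2 ltr_nat.
(* The default value 0 of [xget] would give distance 1, which is never below the bound. *)
case: xgetP => [M _ [eqM _] lt_LM | _]; last by [].
exact: RelS (ltnW lt_LM) eqM.
Qed.

Lemma agree_gg_dist (R : realType) (X Y : marked_group m) L :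
  Rel L X = Rel L Y -> (gg_dist R X Y <= expR (- L%:R))%R.
Proof.
move=> eqL; rewrite /gg_dist; case: asboolP => [_|]; first exact: expR_ge0.
move=> /existsNP[L0 neL0]; rewrite ler_expR lerN2 ler_nat.
(* One level of disagreement bounds all levels of agreement, so a largest one exists. *)
have bnd L' : `[< Rel L' X = Rel L' Y >] -> (L' <= L0)%N.
  move=> /asboolP eqL'; rewrite leqNgt; apply/negP => /ltnW lt_L0.
  exact/neL0/(RelS lt_L0).
have ex : exists L', `[< Rel L' X = Rel L' Y >] by exists L; apply/asboolP.
case: (ex_maxnP ex bnd) => M /asboolP eqM maxM.
have maxM' : max_agreement X Y M by split=> // L' eqL'; apply: maxM; apply/asboolP.
case: xgetP => [M' _ [_ maxL]|/(_ M)]; [exact: maxL | by []].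
Qed.

End Words.

(** This is the strong property. Surjectivity turns the image of a generating tuple into a marking
    of the quaternion group. *)
Definition residually_onto_quaternion (G : groupType) : Prop :=
  forall E : seq G, exists2 n, (2 < n)%N &
  exists f : {multiplicative G -> quaternion n},
    {in E &, injective f} /\ forall y, exists x, f x = y.

Lemma fin_generated_tuple (G : groupType) : fin_generated G ->
  exists2 m, (0 < m)%N & exists S : m.-tuple G, gspan [set` S] = setT.
Proof.
move=> [A /finite_seqP[s ->] genA]; exists (size s).+1 => //.
(* Prepending 1 makes the tuple nonempty. *)
exists (in_tuple (1 :: s)); apply/seteqP; split=> // x _.
have : gspan [set` s] x by rewrite genA.
apply: gspan_min; first exact: gspan_subgroup.
by move=> y sy; apply: gspan_id; rewrite /= inE [_ \in s]sy orbT.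
Qed.

Lemma residually_onto_quaternion_limit (R : realType) (G : groupType) :
  fin_generated G -> residually_onto_quaternion G -> quaternion_limit R G.
Proof.
move=> /fin_generated_tuple[m m_gt0 [S gS]] rqG; exists m => //; exists S, gS.
have /choice[X XP] i : exists X : marked_group m,
    quaternion_group (mg_group X) /\ Rel i X = Rel i (MarkedGroup gS).
  (* With 1 in the list, injectivity detects which words of length at most [i] are relations. *)
  have [n n_gt2 [f [fI fS]]] := rqG (1 :: [seq seq_eval S w | w <- word_ball m i]).
  have gfS : gspan [set` map_tuple f S] = setT.
    apply/seteqP; split=> // y _; apply/gspan_seq_eval; have [x <-] := fS y.
    have /gspan_seq_eval[w <-] : gspan [set` S] x by rewrite gS.
    by exists w; exact: seq_eval_morph.
  exists (MarkedGroup gfS); split.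
    by exists n => //; exists idfun; exists idfun.
  have fE (w : free_word m) : (size (sval w) <= i)%N ->
      word_eval (map_tuple f S) w = 1 <-> word_eval S w = 1.
    move=> w_le; have -> : word_eval (map_tuple f S) w = f (word_eval S w).
      exact: seq_eval_morph.
    split=> [fw|->]; last exact: multiplicative1.
    apply: fI; rewrite ?multiplicative1 //; last exact: mem_head.
    by rewrite inE (map_f (seq_eval S)) ?orbT // mem_word_ball.
  by apply/seteqP; split=> w [ws /= wE]; split=> //; exact/fE.
exists X; split=> [i|]; first by case: (XP i).
(* Agreement up to [i] bounds the distance by [expR (- i%:R)], which is at most the inverse of
   [i.+1]. *)
apply: (@squeeze_cvgr _ _ _ _ (cst 0%R) (fun i : nat => i.+1%:R^-1%R : R)).
- near=> i; apply/andP; split.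
    by rewrite /gg_dist; case: ifP => // _; exact: expR_ge0.
  apply: (@le_trans _ _ (expR (- i%:R))).
    by apply: agree_gg_dist; case: (XP i).
  rewrite expRN lef_pV2 ?posrE ?expR_gt0 ?ltr0n //.
  by rewrite -natr1 addrC expR_ge1Dx.
- exact: cvg_cst.
- exact: cvg_harmonic.
Unshelve. all: by end_near.
Qed.

Lemma quaternion_limit_locally (R : realType) (G : groupType) :
  quaternion_limit R G -> locally_quaternion G.
Proof.
move=> [m _ [S [gS [X [Xq Xlim]]]]] E.
have /choice[W WE] x : exists w, seq_eval S w = x.
  by apply/gspan_seq_eval; rewrite gS.
(* The words [eqM] and [eqI] express a product and an equality in [G] as relations; [L] bounds the
   lengths of all those coming from [E]. *)
pose eqM (p : G * G) := W p.1 ++ W p.2 ++ inv_seq (W (p.1 * p.2)).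
pose eqI (p : G * G) := W p.1 ++ inv_seq (W p.2).
pose P := [seq (x, y) | x <- E, y <- E].
pose L := \sum_(p <- P) (size (eqM p) + size (eqI p))%N.
have sizeL p : p \in P -> (size (eqM p) <= L)%N /\ (size (eqI p) <= L)%N.
  move=> pP; rewrite /L (big_rem p) //= -addnA leq_addr; split=> //.
  by rewrite addnCA leq_addr.
have [i XL] : exists i, Rel L (X i) = Rel L (MarkedGroup gS).
  have /filter_ex[i Xi] : \forall i \near \oo,
      (gg_dist R (X i) (MarkedGroup gS) < expR (- L%:R))%R.
    by apply: (cvgr_lt _ Xlim); exact: expR_gt0.
  by exists i; exact: gg_dist_agree Xi.
have eval1 w : (size w <= L)%N -> seq_eval (mg_gens (X i)) w = 1 <-> seq_eval S w = 1.
  move=> w_le; have [v [v_le vE]] := free_reduction w; rewrite -!vE.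
  have v_leL := leq_trans v_le w_le.
  have : Rel L (X i) v <-> Rel L (MarkedGroup gS) v by rewrite XL.
  by rewrite /Rel /=; case=> XS SX; split=> vw; [case: XS | case: SX].
have [n n_gt2 [h h_bij]] := Xq i; exists n => //.
exists (fun x => h (seq_eval (mg_gens (X i)) (W x))); split=> x y Ex Ey.
  move=> /(bij_inj h_bij) xy; rewrite -(WE x) -(WE y).
  have pP : (x, y) \in P by apply/allpairsP; exists (x, y).
  have [_ /eval1] := sizeL _ pP.
  rewrite !seq_eval_cat !seq_evalV /= xy mulgV => -[/(_ erefl) xy1 _].
  exact: divg1_eq xy1.
have pP : (x, y) \in P by apply/allpairsP; exists (x, y).
have [/eval1 eqXS _] := sizeL _ pP; have := eqXS.2.
rewrite /eqM !seq_eval_cat !seq_evalV /= !WE mulgA mulgV => /(_ erefl).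
by rewrite mulgA => /divg1_eq <-; rewrite gmulfM.
Qed.

(** * Ultraproducts and universal theory *)

Lemma residually_onto_fully (G : groupType) :
  residually_onto_quaternion G -> fully_residually_quaternion G.
Proof.
move=> rqG E /finite_seqP[s ->]; have [n n_gt2 [f [fI _]]] := rqG s.
by exists n => //; exists f => x y; rewrite !inE; exact: fI.
Qed.

Lemma fully_residually_locally (G : groupType) :
  fully_residually_quaternion G -> locally_quaternion G.
Proof.
move=> rqG E.
have [|n n_gt2 [f fI]] := rqG [set` E]; first by apply/finite_seqP; exists E.
exists n => //; exists f; split=> x y Ex Ey; last exact: gmulfM.
by apply: fI; rewrite inE.
Qed.

Lemma near_all_seq (I : Type) (T : eqType) (F : set_system I) (s : seq T)
    (P : T -> I -> Prop) : Filter F ->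
  (forall x, x \in s -> \forall i \near F, P x i) ->
  \forall i \near F, forall x, x \in s -> P x i.
Proof.
move=> FF; elim: s => [|a s IH] Ps; first exact: filterE.
have Pa := Ps a (mem_head _ _).
have {}IH := IH (fun x xs => Ps x (@mem_behead _ (a :: s) x xs)).
apply: filterS2 Pa IH => i Pai Psi x; rewrite inE => /predU1P[->|] //; exact: Psi.
Qed.

Lemma residually_onto_ultraproduct (G : groupType) : fin_generated G ->
  residually_onto_quaternion G -> embeds_in_quaternion_ultraproduct G.
Proof.
move=> /fin_generated_tuple[m _ [S gS]] rqG.
have /choice[p pP] (i : nat) : exists p : {n : nat & {multiplicative G -> quaternion n}},
    (2 < projT1 p)%N /\
    {in [seq seq_eval S w | w <- word_ball m i] &, injective (projT2 p)}.
  have [n n_gt2 [f [fI _]]] := rqG [seq seq_eval S w | w <- word_ball m i].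
  by exists (existT _ n f).
(* The ultrafilter contains all cofinite sets, so it meets indices beyond the lengths of any two
   given words. *)
have [U [UU sU]] := ultraFilterLemma eventually_filter.
pose H i := quaternion (projT1 (p i)).
pose f0 (x : G) : prodg H := fun i => projT2 (p i) x.
pose f x : ultraproduct UU H := quotg_pi (ultra_congruence UU H) (f0 x).
have fM : {morph f : x y / x * y}.
  move=> x y; rewrite /f -quotg_pi_morph; congr quotg_pi.
  by apply: functional_extensionality_dep => i; exact: gmulfM.
have fI : injective f.
  move=> x y /quotg_piP fxy.
  have wE z : exists w, seq_eval S w = z by apply/gspan_seq_eval; rewrite gS.
  have [[v vE] [w wE']] := (wE x, wE y).
  have large : U [set i | (maxn (size v) (size w) <= i)%N].
    by apply: sU; exact: nbhs_infty_ge.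
  have [i [fi /= i_ge]] := filter_ex (filterI fxy large).
  move: i_ge; rewrite geq_max => /andP[vi wi]; have [_ inj] := pP i.
  apply: inj fi; first by rewrite -vE map_f // mem_word_ball.
  by rewrite -wE' map_f // mem_word_ball.
pose f' : {multiplicative G -> ultraproduct UU H} :=
  HB.pack f (isMultiplicative.Build _ _ f fM).
exists U, UU, H; split; last by exists f'.
move=> i; exists (projT1 (p i)); first by case: (pP i).
by exists idfun; exists idfun.
Qed.

Lemma ultraproduct_locally (G : groupType) :
  embeds_in_quaternion_ultraproduct G -> locally_quaternion G.
Proof.
move=> [U [UU [H [Hq [f fI]]]]] E.
pose r x : prodg H := repr (f x : quotg _).
have rE x : quotg_pi (ultra_congruence UU H) (r x) = f x by exact: quotg_pi_repr.
have rM x y : \forall i \near U, r (x * y) i = r x i * r y i.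
  have : quotg_pi (ultra_congruence UU H) (r (x * y)) = quotg_pi _ (r x * r y).
    rewrite quotg_pi_morph !rE; exact: gmulfM.
  by move/quotg_piP.
have rI x y : x != y -> \forall i \near U, r x i <> r y i.
  move=> /eqP neq_xy.
  have [eq_r|//] := in_ultra_setVsetC [set i | r x i = r y i] UU.
  by case: neq_xy; apply: fI; rewrite -!rE; apply/quotg_piP.
pose P := [seq (x, y) | x <- E, y <- E].
(* Finitely many conditions, each true nearly everywhere, hold together at some index; the
   representatives there form the local embedding. *)
have : \forall i \near U, forall p, p \in P ->
    r (p.1 * p.2) i = r p.1 i * r p.2 i /\ (p.1 != p.2 -> r p.1 i <> r p.2 i).
  apply: near_all_seq => -[x y] _ /=; have [_|neq_xy] := eqVneq x y.
    by apply: filterS (rM x y) => i.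
  by apply: filterS2 (rM x y) (rI x y neq_xy) => i.
move=> /filter_ex[i iP]; have [n n_gt2 [h h_bij]] := Hq i.
exists n => //; exists (fun x => h (r x i)); split=> x y Ex Ey.
  move=> /(bij_inj h_bij) xy; apply/eqP/negPn/negP => neq_xy.
  have [|_ /(_ neq_xy)//] := iP (x, y).
  by apply/allpairsP; exists (x, y).
rewrite -gmulfM; congr (h _); have [|//] := iP (x, y).
by apply/allpairsP; exists (x, y).
Qed.

(** * Universal sentences and morphisms *)

Fixpoint formula_values (G : groupType) (e : nat -> G) (f : gformula) : seq G :=
  match f with
  | GEq t1 t2 => [:: term_eval e t1; term_eval e t2]
  | GNot f1 => formula_values e f1
  | GAnd f1 f2 | GOr f1 f2 | GImp f1 f2 => formula_values e f1 ++ formula_values e f2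
  | GForall _ _ | GExists _ _ => [::]
  end.

Section MorphismFormulas.
Variables (G H : groupType) (f : {multiplicative G -> H}).

Lemma term_eval_morph (e : nat -> G) t : term_eval (f \o e) t = f (term_eval e t).
Proof.
elim: t => [i||t IH|t1 IH1 t2 IH2] //=; first by rewrite multiplicative1.
  by rewrite IH multiplicativeV.
by rewrite IH1 IH2 gmulfM.
Qed.

(** Injectivity on the values of the terms preserves equations in both directions, so the
    connectives follow. *)
Lemma holds_morph (e : nat -> G) g : quantifier_free g ->
  {in formula_values e g &, injective f} -> holds (f \o e) g <-> holds e g.
Proof.
have sub (E1 E2 : seq G) : {in E1 ++ E2 &, injective f} ->
    {in E1 &, injective f} /\ {in E2 &, injective f}.
  by move=> fI; split=> x y Ex Ey; apply: fI; rewrite mem_cat ?Ex ?Ey ?orbT.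
elim: g => [t1 t2|g IH|g1 IH1 g2 IH2|g1 IH1 g2 IH2|g1 IH1 g2 IH2| |] //=.
- move=> _ fI; rewrite !term_eval_morph; split=> [|-> //].
  by apply: fI; rewrite !inE eqxx ?orbT.
- by move=> qf fI; rewrite IH.
- by move=> /andP[qf1 qf2] /sub[fI1 fI2]; rewrite IH1 // IH2.
- by move=> /andP[qf1 qf2] /sub[fI1 fI2]; rewrite IH1 // IH2.
- by move=> /andP[qf1 qf2] /sub[fI1 fI2]; rewrite IH1 // IH2.
Qed.

End MorphismFormulas.

(* Falsity of a universal formula at [e] is witnessed by finitely many
   equalities and inequalities between values of terms, hence survives any
   morphism that is injective on those values. *)
Lemma universal_prenex_reflected (G : groupType) g (e : nat -> G) :
  universal_prenex g -> exists E : seq G,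
  forall (H : groupType) (f : {multiplicative G -> H}), {in E &, injective f} ->
  holds (f \o e) g -> holds e g.
Proof.
have qf_case g' e' : quantifier_free g' -> exists E : seq G,
    forall (H : groupType) (f : {multiplicative G -> H}), {in E &, injective f} ->
    holds (f \o e') g' -> holds e' g'.
  move=> qf; exists (formula_values e' g') => H f fI.
  by rewrite holds_morph.
elim: g e => [*|*|*|*|*|i g IH e /= ug|*]; try exact: qf_case.
have [e_g|/existsNP[x nex]] := pselect (forall x, holds (update e i x) g).
  by exists [::].
have [E EP] := IH (update e i x) ug; exists E => H f fI Hg.
case: nex; apply: (EP H f fI).
have -> : f \o update e i x = update (f \o e) i (f x); last exact: Hg.
by apply: functional_extensionality_dep => j; rewrite /update /=; case: ifP.
Qed.

Lemma fully_residually_Th_forall (G : groupType) : fully_residually_quaternion G ->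
  \bigcap_(n in [set n | (3 <= n)%N]) Th_forall (quaternion n) `<=` Th_forall G.
Proof.
move=> rqG g gT; have [usg _] := gT 3%N isT; split=> // e.
have [_ [g' [_ ug' gg']]] := usg.
apply/gg'; have [E EP] := universal_prenex_reflected e ug'.
have [|n n_gt2 [f fI]] := rqG [set` E]; first by apply/finite_seqP; exists E.
apply: (EP _ f) => [x y Ex Ey|]; first by apply: fI; rewrite inE.
by apply/gg'; have [_] := gT n n_gt2; apply.
Qed.

Definition big_and (T : Type) (F : T -> gformula) (s : seq T) : gformula :=
  foldr (fun x g => GAnd (F x) g) (GEq GOne GOne) s.

Lemma holds_big_and (M : baseGroupType) (e : nat -> M) (T : eqType)
    (F : T -> gformula) s :
  holds e (big_and F s) <-> (forall x, x \in s -> holds e (F x)).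
Proof.
elim: s => [|a s IH] /=; first by split.
rewrite IH; split=> [[ea es] x|es]; first by rewrite inE => /predU1P[->|/es].
split=> [|x xs]; first exact/es/mem_head.
by apply: es; rewrite inE xs orbT.
Qed.

Lemma holds_closure (M : baseGroupType) s f :
  (forall e : nat -> M, holds e (foldr GForall f s)) <-> (forall e : nat -> M, holds e f).
Proof.
elim: s => [|i s IH] //=; split=> [es|/IH es e x]; last exact: es.
apply/IH => e; have := es e (e i); congr (holds _ _).
by apply: functional_extensionality_dep => j; rewrite /update; case: eqP => [->|].
Qed.

Lemma free_vars_closure s f :
  free_vars (foldr GForall f s) = [seq j <- free_vars f | j \notin s].
Proof.
elim: s => [|i s IH] /=; first by rewrite filter_predT.
by rewrite IH -filter_predI; apply: eq_filter => j; rewrite /= inE negb_or.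
Qed.

Lemma universal_prenex_closure s f :
  quantifier_free f -> universal_prenex (foldr GForall f s).
Proof. by move=> qf; elim: s => [|i s IH] //=; case: f qf. Qed.

(* The diagram of the partial multiplication table of [E] is an existential
   statement, and its negation is a universal one. *)
Lemma Th_forall_locally (G : groupType) :
  \bigcap_(n in [set n | (3 <= n)%N]) Th_forall (quaternion n) `<=` Th_forall G ->
  locally_quaternion G.
Proof.
move=> ThG E; apply: contrapT => noE.
pose P := [seq (x, y) | x <- E, y <- E].
(* Products get variables of their own, even those that leave [E]. *)
pose es := E ++ [seq p.1 * p.2 | p <- P].
pose var x := GVar (index x es).
pose diag (p : G * G) := GAnd (GEq (GMul (var p.1) (var p.2)) (var (p.1 * p.2)))
  (if p.1 == p.2 then GEq GOne GOne else GNot (GEq (var p.1) (var p.2))).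
pose table := big_and diag P.
pose phi := foldr GForall (GNot table) (iota 0 (size es)).
have Pe p : p \in P -> [/\ p.1 \in es, p.2 \in es & p.1 * p.2 \in es].
  move=> pP; rewrite !mem_cat (map_f (fun q : G * G => q.1 * q.2) pP) orbT.
  by case/allpairsP: pP => q [q1 q2 ->]; rewrite q1 q2.
have qf_table : quantifier_free table.
  by rewrite /table; elim: (P) => [|p s IH] //=; rewrite IH andbT; case: ifP.
have closed_table j : j \in free_vars table -> j \in iota 0 (size es).
  suff gen s : {subset s <= P} ->
      j \in free_vars (big_and diag s) -> j \in iota 0 (size es) by exact: gen.
  elim: s => [|p s IH] // sP.
  rewrite -[free_vars _]/(free_vars (diag p) ++ free_vars (big_and diag s)) mem_cat.
  case/orP=> [|/IH]; last first.
    by apply=> q qs; apply: sP; rewrite inE qs orbT.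
  have [e1 e2 e12] := Pe p (sP _ (mem_head _ _)); rewrite mem_iota add0n /=.
  have inI x : x \in es -> j == index x es -> (j < size es)%N.
    by move=> xes /eqP->; rewrite index_mem.
  move: (inI _ e1) (inI _ e2) (inI _ e12).
  case: (p.1 == p.2); rewrite /= !inE; case: (j == index p.1 es);
    case: (j == index p.2 es); case: (j == index (p.1 * p.2) es) => //= i1 i2 i12 _;
    by [exact: i1 | exact: i2 | exact: i12].
have sphi : universal_sentence phi.
  have phi_closed : sentence phi.
    rewrite /sentence /nilp /phi free_vars_closure size_filter -leqn0 leqNgt -has_count.
    by apply/hasPn => j /closed_table; rewrite negbK.
  split=> //; exists phi; split=> //; exact: universal_prenex_closure.
have [_ /holds_closure phiG] : Th_forall G phi.
  (* An assignment satisfying the table in a quaternion group would be a local embedding of [E],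
     excluded by [noE]. *)
  apply: ThG => n n_gt2; split=> //; apply/holds_closure => e /= /holds_big_and eP.
  apply: noE; exists n => //; exists (fun x => e (index x es)).
  split=> x y Ex Ey; last first.
    by have [] := eP (x, y) (allpairs_f _ Ex Ey).
  have [_ /=] := eP (x, y) (allpairs_f _ Ex Ey).
  by case: eqVneq.
(* In [G] itself the table is satisfied by giving each variable the element it names. *)
apply: (phiG (nth 1 es)); apply/holds_big_and => p pP; have [e1 e2 e12] := Pe p pP.
split; rewrite /= ?nth_index //.
by case: eqVneq => //= /eqP neq; rewrite !nth_index.
Qed.

(** * Equivalence of the five conditions through the weak and strong properties *)

Lemma residually_onto_ql_group (G : groupType) l k : nonabelian G -> (0 < k)%N ->
  gisomorphic G (ql_group l k) -> residually_onto_quaternion G.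
Proof.
move=> Gna k_gt0 [g g_bij] E.
have ql_na : nonabelian (ql_group l k).
  move=> abQ; apply: Gna => x y; apply: (bij_inj g_bij).
  by rewrite !gmulfM; exact: abQ.
have [n n_gt2 [f [fI fS]]] := ql_group_residual (map g E) k_gt0 ql_na.
exists n => //; exists (f \o g : {multiplicative G -> _}); split=> [x y Ex Ey /= fxy|y].
  by apply/(bij_inj g_bij)/fI; rewrite ?map_f.
have [g' _ g'K] := g_bij; have [x <-] := fS y.
by exists (g' x); rewrite /= g'K.
Qed.

Lemma locally_quaternion_ql_group (G : groupType) : nonabelian G -> fin_generated G ->
  locally_quaternion G ->
  exists l k : nat, (1 <= k)%N /\ gisomorphic G (ql_group l k).
Proof.
move=> Gna Gfg /locally_quaternion_index2 /(_ Gna) [C [w [t [Cw nCt]]]].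
exact: index2_inverted_ql_group Gfg Cw nCt.
Qed.

Theorem theorem6 (R : realType) (G : groupType)
    (Gna : nonabelian G) (Gfg : fin_generated G) :
  [<-> quaternion_limit R G;
       fully_residually_quaternion G;
       exists l k : nat, (1 <= k)%N /\ gisomorphic G (ql_group l k);
       \bigcap_(n in [set n | (3 <= n)%N]) Th_forall (quaternion n) `<=` Th_forall G;
       embeds_in_quaternion_ultraproduct G].
Proof.
have iso_onto : (exists l k : nat, (1 <= k)%N /\ gisomorphic G (ql_group l k)) ->
    residually_onto_quaternion G.
  by move=> [l [k [k_gt0 iso]]]; exact: residually_onto_ql_group Gna k_gt0 iso.
have local_iso := locally_quaternion_ql_group Gna Gfg.
tfae.
- by move=> /quaternion_limit_locally/local_iso/iso_onto/residually_onto_fully.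
- by move=> /fully_residually_locally/local_iso.
- by move=> /iso_onto/residually_onto_fully/fully_residually_Th_forall.
- by move=> /Th_forall_locally/local_iso/iso_onto/(residually_onto_ultraproduct Gfg).
- move=> /ultraproduct_locally/local_iso/iso_onto.
  exact: residually_onto_quaternion_limit Gfg.
Qed.
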